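(* Let the channel vectors $h_i$ ($i\in\mathcal K_I$), $g_j$ ($j\in\mathcal K_E$) be random and satisfy the channel assumption stated in the context. Then with probability one the following holds: if the standing (non-trivial case) assumption of the context is satisfied, then the optimal solution $(\{W_i^\star\}_{i\in\mathcal K_I},W_E^\star)$ of the semidefinite program (SDR1) $$\max_{\{W_i\},W_E}\ \sum_{i\in\mathcal K_I}\mathrm{tr}(GW_i)+\mathrm{tr}(GW_E)$$ subject to $$\frac{\mathrm{tr}(h_i^Hh_iW_i)}{\gamma_i}-\sum_{k\ne i,\,k\in\mathcal K_I}\mathrm{tr}(h_i^Hh_iW_k)-\mathrm{tr}(h_i^Hh_iW_E)-\sigma_i^2\ge 0\quad\forall i\in\mathcal K_I,$$ $$\sum_{i\in\mathcal K_I}\mathrm{tr}(W_i)+\mathrm{tr}(W_E)\le P,\qquad W_i\succeq 0\ \forall i\in\mathcal K_I,\quad W_E\succeq 0$$ (over Hermitian $M\times M$ matrices) satisfies $\mathrm{rank}(W_i^\star)=1$ for all $i\in\mathcal K_I$ and $W_E^\star=0$.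
   Context: Setting. $M>1$ is an integer, $\mathcal K_I=\{1,\dots,K_I\}$, $\mathcal K_E=\{1,\dots,K_E\}$ with $K_I,K_E\ge1$. $h_i\in\mathbb C^{1\times M}$ ($i\in\mathcal K_I$) and $g_j\in\mathbb C^{1\times M}$ ($j\in\mathcal K_E$) are row vectors. The constants are $P>0$, $\sigma_i^2>0$, $\gamma_i>0$ ($i\in\mathcal K_I$), $\alpha_j\ge0$ ($j\in\mathcal K_E$), $0<\zeta\le1$. Put $G=\zeta\sum_{j\in\mathcal K_E}\alpha_jg_j^Hg_j\succeq0$; $\xi_E$ denotes the largest (dominant) eigenvalue of $G$ and $v_E\in\mathbb C^{M\times1}$ the corresponding unit-norm eigenvector. Channel assumption (independently distributed user channels). The vectors $h_i$, $g_j$ are independently drawn from continuous distributions $f_{h_i}$, $f_{g_j}$. Moreover, for any $d\times M$ matrix $F$ with $0<d\le M$ whose $d$ rows form any subset of the channel vectors $\{h_i\}\cup\{g_j\}$, it holds with probability one that (i) $\mathrm{rank}(F)=d$, and (ii) the ordered nonzero singular values of $F$ are strictly decreasing, $\tau_1>\cdots>\tau_d>0$. Standing (non-trivial case) assumption. (a) Feasibility: there exist $w_i\in\mathbb C^{M\times1}$, $i\in\mathcal K_I$, with $\dfrac{|h_iw_i|^2}{\sum_{k\ne i}|h_iw_k|^2+\sigma_i^2}\ge\gamma_i$ for all $i\in\mathcal K_I$ and $\sum_i\|w_i\|^2\le P$. (b) Aligning all beams with $v_E$ is infeasible: there is no $\{p_i\ge0\}_{i\in\mathcal K_I}$ with $\sum_ip_i\le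 P$ and $\dfrac{p_i|h_iv_E|^2}{\sum_{k\ne i}p_k|h_iv_E|^2+\sigma_i^2}\ge\gamma_i$ for all $i\in\mathcal K_I$.
   Formalization: The formal theorem assumes in addition that some α_j > 0; if all α_j = 0 then G = 0, the objective is constant, every feasible point is optimal, v_E is undetermined and the claim fails (e.g. M = K_I = 2, γ_i = 1, P large). Continuous distributions are read as having densities. *)

(* Defs.v *)
From HB Require Import structures.
From mathcomp Require Import all_boot all_order all_algebra.
From mathcomp Require Import complex.
From mathcomp Require Import all_classical all_reals all_analysis.

Set Implicit Arguments.
Unset Strict Implicit.
Unset Printing Implicit Defensive.

Import Order.TTheory GRing.Theory Num.Theory.

Local Open Scope classical_set_scope.
Local Open Scope ring_scope.
Local Open Scope complex_scope.
Local Open Scope sesquilinear_scope.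

(* Throughout, `<=` on R[i] is the MathComp partial order: x <= y means that
   x and y have the same imaginary part and Re x <= Re y.  It is only used
   between quantities that are real (squared moduli, traces of products of
   Hermitian matrices), where it is the order of the reals. *)

Section LinearAlgebra.
Context {R : realType}.

Definition sqnorm M (w : 'cV[R[i]]_M) : R[i] := \sum_m `|w m 0| ^+ 2.

Definition psdmx M (A : 'M[R[i]]_M) : Prop :=
  A \is hermsymmx /\ forall x : 'cV[R[i]]_M, 0 <= (x^t* *m A *m x) 0 0.

Definition dominant_eigenvalue M (A : 'M[R[i]]_M) (xi : R) : Prop :=
  eigenvalue A xi%:C /\ forall a : R[i], eigenvalue A a -> a <= xi%:C.

Definition unit_dominant_eigenvector M (A : 'M[R[i]]_M) (v : 'cV[R[i]]_M) :
    Prop :=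
  exists xi : R,
    [/\ dominant_eigenvalue A xi, A *m v = xi%:C *: v & sqnorm v = 1].

(* Singular values of a wide matrix (d <= M), with multiplicity: the square
   roots of the d eigenvalues of F F^H. *)
Definition singular_values d M (F : 'M[R[i]]_(d, M)) (tau : 'I_d -> R) : Prop :=
  (forall k, 0 <= tau k) /\
  char_poly (F *m F^t*) = \prod_k ('X - ((tau k ^+ 2)%:C)%:P).

End LinearAlgebra.

Section RandomVectors.
Context {R : realType}.

(* The identification of C^M with R^(2M), real parts first. *)
Definition real_coords M (v : 'rV[R[i]]_M) : (M + M).-tuple R :=
  [tuple match fintype.split k with
         | inl m => complex.Re (v 0 m)
         | inr m => complex.Im (v 0 m)
         end | k < M + M].

(* Integral over R^n, as an iterated one-dimensional Lebesgue integral; for the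
   nonnegative measurable integrands below this is, by Tonelli, the integral
   with respect to n-dimensional Lebesgue measure. *)
Fixpoint tuple_integral n : (n.-tuple R -> \bar R) -> \bar R :=
  match n return (n.-tuple R -> \bar R) -> \bar R with
  | 0 => fun F => F (nil_tuple R)
  | n'.+1 => fun F =>
      (\int[@lebesgue_measure R]_x
         tuple_integral (fun t : n'.-tuple R => F (@cons_tuple n' R x t)))%E
  end.

Context {d : measure_display} {T : measurableType d} (Pr : probability T R).

Definition random_vector M (X : T -> 'rV[R[i]]_M) : Prop :=
  measurable_fun [set: T] (fun t => real_coords (X t)).

Definition has_density M (X : T -> 'rV[R[i]]_M) (f : (M + M).-tuple R -> R) :
    Prop :=
  [/\ measurable_fun [set: (M + M).-tuple R] f,
      forall x, 0 <= f x &
      forall A : set ((M + M).-tuple R), measurable A ->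
        Pr [set t | A (real_coords (X t))] =
        tuple_integral (fun x => (f x * \1_A x)%:E)].

Definition mutually_independent (I : finType) M (X : I -> T -> 'rV[R[i]]_M) :
    Prop :=
  forall (J : {set I}) (A : I -> set ((M + M).-tuple R)),
    (forall i, measurable (A i)) ->
    Pr [set t | forall i, i \in J -> A i (real_coords (X i t))] =
    (\big[*%E/1]_(i in J) Pr [set t | A i (real_coords (X i t))])%E.

End RandomVectors.

Section Channels.
Context {R : realType} {M KI KE : nat}.

Definition channels (T : Type) (h : 'I_KI -> T -> 'rV[R[i]]_M)
    (g : 'I_KE -> T -> 'rV[R[i]]_M) (s : 'I_KI + 'I_KE) : T -> 'rV[R[i]]_M :=
  match s with inl i => h i | inr j => g j end.

Definition channel_matrix (T : Type) (h : 'I_KI -> T -> 'rV[R[i]]_M)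
    (g : 'I_KE -> T -> 'rV[R[i]]_M) n (f : 'I_n -> 'I_KI + 'I_KE) (t : T) :
    'M[R[i]]_(n, M) :=
  \matrix_(k < n) channels h g (f k) t.

Definition channel_assumption (d : measure_display) (T : measurableType d)
    (Pr : probability T R) (h : 'I_KI -> T -> 'rV[R[i]]_M)
    (g : 'I_KE -> T -> 'rV[R[i]]_M) : Prop :=
  [/\ forall s, random_vector (channels h g s),
      mutually_independent Pr (channels h g),
      forall s, exists f, has_density Pr (channels h g s) f &
      forall (n : nat) (f : 'I_n -> 'I_KI + 'I_KE),
        (0 < n <= M)%N -> injective f ->
        {ae Pr, forall t,
          \rank (channel_matrix h g f t) = n /\
          exists tau : 'I_n -> R,
            [/\ singular_values (channel_matrix h g f t) tau,
                forall k l : 'I_n, (k < l)%N -> tau l < tau k &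
                forall k, 0 < tau k]}].

End Channels.

Section Beamforming.
Context {R : realType} {M KI KE : nat}.
Implicit Types (h : 'I_KI -> 'rV[R[i]]_M) (g : 'I_KE -> 'rV[R[i]]_M).
Implicit Types (sigmasq gamma : 'I_KI -> R) (P : R).

Definition energy_mx (zeta : R) (alpha : 'I_KE -> R) g : 'M[R[i]]_M :=
  zeta%:C *: \sum_j (alpha j)%:C *: ((g j)^t* *m g j).

Definition beamforming_feasible h sigmasq gamma P : Prop :=
  exists w : 'I_KI -> 'cV[R[i]]_M,
    (forall i,
       (gamma i)%:C <=
       `|(h i *m w i) 0 0| ^+ 2 /
       (\sum_(k | k != i) `|(h i *m w k) 0 0| ^+ 2 + (sigmasq i)%:C)) /\
    \sum_i sqnorm (w i) <= P%:C.

Definition aligned_feasible h sigmasq gamma P (vE : 'cV[R[i]]_M) : Prop :=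
  exists p : 'I_KI -> R,
    [/\ forall i, 0 <= p i,
        \sum_i p i <= P &
        forall i,
          (gamma i)%:C <=
          (p i)%:C * `|(h i *m vE) 0 0| ^+ 2 /
          (\sum_(k | k != i) (p k)%:C * `|(h i *m vE) 0 0| ^+ 2 +
           (sigmasq i)%:C)].

Definition nontrivial_case h sigmasq gamma P (vE : 'cV[R[i]]_M) : Prop :=
  beamforming_feasible h sigmasq gamma P /\
  ~ aligned_feasible h sigmasq gamma P vE.

Definition SDR1_objective (G : 'M[R[i]]_M) (W : 'I_KI -> 'M[R[i]]_M)
    (WE : 'M[R[i]]_M) : R[i] :=
  \sum_i \tr (G *m W i) + \tr (G *m WE).

Definition SDR1_feasible h sigmasq gamma P (W : 'I_KI -> 'M[R[i]]_M)
    (WE : 'M[R[i]]_M) : Prop :=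
  [/\ forall i,
        0 <= \tr ((h i)^t* *m h i *m W i) / (gamma i)%:C
             - \sum_(k | k != i) \tr ((h i)^t* *m h i *m W k)
             - \tr ((h i)^t* *m h i *m WE) - (sigmasq i)%:C,
      \sum_i \tr (W i) + \tr WE <= P%:C,
      forall i, psdmx (W i) &
      psdmx WE].

Definition SDR1_optimal h sigmasq gamma P (G : 'M[R[i]]_M)
    (W : 'I_KI -> 'M[R[i]]_M) (WE : 'M[R[i]]_M) : Prop :=
  SDR1_feasible h sigmasq gamma P W WE /\
  forall (W' : 'I_KI -> 'M[R[i]]_M) (WE' : 'M[R[i]]_M),
    SDR1_feasible h sigmasq gamma P W' WE' ->
    SDR1_objective G W' WE' <= SDR1_objective G W WE.

End Beamforming.

(* Main.v *)
(** Lagrange multipliers of the semidefinite program (from the Fan-Glicksberg-Hoffman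
    alternative) give dual matrices [A_E] and [A_i = A_E - c_i h_i^H h_i], positive
    semidefinite, with [A_E W_E = 0] and [A_i W_i = 0].  If [A_E] is invertible, then
    [W_E = 0] and each [W_i] has rank one.  Otherwise a kernel vector of [A_E] is an
    eigenvector of [G] for a nonzero eigenvalue, orthogonal to every [h_i] with a nonzero
    multiplier.  So the claim, and the exclusion of aligned beams, reduce to: almost
    surely no eigenvector of [G] for a nonzero eigenvalue is orthogonal to some [h_i].
    This follows from the nonvanishing of a minor of the Krylov matrix with rows
    [h_i G^k], which is a polynomial in the real coordinates of the channels; it does not
    vanish identically (Vandermonde), and independent vectors with densities almost
    surely avoid the zeros of a nonzero polynomial. *)
Require Import Defs.
From HB Require Import structures.
From mathcomp Require Import all_boot all_order all_algebra.
From mathcomp Require Import complex ring lra.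
From mathcomp Require Import all_classical all_reals all_analysis measurable_realfun.

Set Implicit Arguments.
Unset Strict Implicit.
Unset Printing Implicit Defensive.

Import Order.TTheory GRing.Theory Num.Theory.

Local Open Scope classical_set_scope.
Local Open Scope ring_scope.

(** * Theorem of the alternative for affine functions on convex sets *)

Section FritzJohn.
Context {R : realType} {X : Type} (comb : R -> X -> X -> X).
Implicit Types (C : set X) (f g : X -> R).

Definition convex_for C :=
  forall s x y, 0 <= s <= 1 -> C x -> C y -> C (comb s x y).

Definition affine_for f :=
  forall s x y, 0 <= s <= 1 -> f (comb s x y) = s * f x + (1 - s) * f y.

(** If [g] were positive at a zero [y] of [f], a short move from [y] towards a point where [f] is
    positive would make both positive. *)
Lemma affine_le0_closure C f g :
  convex_for C -> affine_for f -> affine_for g ->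
  (exists2 x, C x & 0 < f x) ->
  (forall x, C x -> 0 < f x -> g x <= 0) ->
  forall x, C x -> f x = 0 -> g x <= 0.
Proof.
move=> Ccv faff gaff [x0 Cx0 fx0] gle y Cy fy.
rewrite leNgt; apply/negP => gy.
have gx0 := gle _ Cx0 fx0.
(* With this weight [g] takes the value [g y / 2] at the mixture of [x0] and [y]. *)
pose s := g y / (2 * (g y - g x0)).
have dgt : 0 < 2 * (g y - g x0) by lra.
have s0 : 0 < s by rewrite divr_gt0.
have s1 : s <= 1 by rewrite ler_pdivrMr // mul1r; lra.
have s01 : 0 <= s <= 1 by rewrite ltW.
have := gle _ (Ccv _ _ _ s01 Cx0 Cy).
rewrite faff // gaff // fy mulr0 addr0 => /(_ (mulr_gt0 s0 fx0)).
have -> : s * g x0 + (1 - s) * g y = g y - s * (2 * (g y - g x0)) / 2 by lra.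
rewrite divfK ?gt_eqF //; lra.
Qed.

(** The multiplier is the infimum of [- g / f] where [f] is positive. Points with [f] negative bound
    these ratios from below: on a segment joining the two sides [f] vanishes somewhere, and there
    [g] is nonpositive. *)
Lemma affine_pair_multiplier C f g :
  convex_for C -> affine_for f -> affine_for g ->
  (exists2 x, C x & 0 < f x) ->
  (forall x, C x -> 0 < f x -> g x <= 0) ->
  exists2 b, 0 <= b & forall x, C x -> g x + b * f x <= 0.
Proof.
move=> Ccv faff gaff fpos gle.
have gle0 := affine_le0_closure Ccv faff gaff fpos gle.
have [x0 Cx0 fx0] := fpos.
pose S := [set - g x / f x | x in [set x | C x /\ 0 < f x]].
have lbS0 : lbound S 0.
  move=> _ [x [Cx fx] <-]; rewrite divr_ge0 ?(ltW fx) // oppr_ge0; exact: gle.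
have S0 : S !=set0 by exists (- g x0 / f x0), x0.
have hasS : has_inf S by split=> //; exists 0.
exists (inf S); first exact: lb_le_inf.
move=> y Cy.
have [fy|fy|fy] := ltgtP 0 (f y).
- have : inf S <= - g y / f y by apply: ge_inf; [exists 0|exists y].
  rewrite ler_pdivlMr //; lra.
- have : g y / - f y <= inf S.
    apply: lb_le_inf => // _ [x [Cx fx] <-].
    have dgt : 0 < f x - f y by lra.
    (* The mixture of [x] and [y] with this weight is the zero of [f] on the segment. *)
    pose s := - f y / (f x - f y).
    have s01 : 0 <= s <= 1.
      by rewrite divr_ge0 ?ler_pdivrMr //; lra.
    have Es : s * (f x - f y) = - f y by rewrite divfK // gt_eqF.
    have := gle0 _ (Ccv _ _ _ s01 Cx Cy).
    rewrite faff // gaff // => /(_ ltac:(lra)) gz.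
    have := ler_wpM2r (ltW dgt) gz.
    rewrite mul0r [X in X <= _](_ : _ = - f y * g x + f x * g y); last first.
      have -> : (s * g x + (1 - s) * g y) * (f x - f y) =
        s * (f x - f y) * g x + ((f x - f y) - s * (f x - f y)) * g y by ring.
      by rewrite Es; ring.
    move=> key.
    rewrite ler_pdivrMr ?oppr_gt0 // mulrAC ler_pdivlMr //; lra.
  rewrite ler_pdivrMr ?oppr_gt0 //; lra.
- rewrite -fy mulr0 addr0; exact: gle0.
Qed.

(* Fan, Glicksberg and Hoffman: the multiplier of the last function is found on
   [C], those of the others on the part of [C] where that function is positive. *)
Lemma affine_multipliers n (f : nat -> X -> R) C :
  C !=set0 -> convex_for C -> (forall k, affine_for (f k)) ->
  ~ (exists2 x, C x & forall k, (k < n)%N -> 0 < f k x) ->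
  exists2 l : nat -> R, (forall k, 0 <= l k) /\ (exists2 k, (k < n)%N & 0 < l k) &
    forall x, C x -> \sum_(k < n) l k * f k x <= 0.
Proof.
elim: n f C => [|n IHn] f C [c Cc] Ccv faff nex.
  by case: nex; exists c.
have [[x0 Cx0 fx0]|nofn] := pselect (exists2 x, C x & 0 < f n x); last first.
  (* When [f n] is nowhere positive on [C], it can carry all the weight. *)
  exists (fun k => (k == n)%:R); first by split=> [k|]; [exact: ler0n|exists n; rewrite ?eqxx].
  move=> x Cx; rewrite big_ord_recr /= big1 ?add0r ?eqxx ?mul1r => [|k _].
    by rewrite leNgt; apply/negP => fx; apply: nofn; exists x.
  by rewrite (ltn_eqF (ltn_ord k)) mul0r.
pose C' := [set x | C x /\ 0 < f n x].
have [||//||l [l0 [k kn lk]] lC'] := IHn f C'.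
- by exists x0.
- move=> s x y s01 [Cx fx] [Cy fy]; split; first exact: Ccv.
  rewrite faff //; case/andP: s01 => s0 s1.
  have [->|sn0] := eqVneq s 0; first by rewrite mul0r add0r subr0 mul1r.
  by rewrite ltr_wpDr ?mulr_ge0 ?mulr_gt0 ?(ltW fy) ?subr_ge0 // lt_def sn0.
- move=> [x [Cx fx] fkx]; apply: nex; exists x => // k.
  by rewrite ltnS leq_eqVlt => /predU1P[->|/fkx].
pose g x := \sum_(k < n) l k * f k x.
have gaff : affine_for g.
  move=> s x y s01; rewrite /g !mulr_sumr -big_split /=.
  by apply: eq_bigr => j _; rewrite faff //; ring.
have [||b b0 gb] := affine_pair_multiplier Ccv (faff n) gaff.
- by exists x0.
- by move=> x Cx fx; apply: lC'.
exists (fun j => if (j < n)%N then l j else b).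
  split=> [j|]; first by case: ifP.
  by exists k; rewrite ?kn // (ltn_trans kn).
move=> x /gb; rewrite big_ord_recr /= ltnn; congr (_ + _ <= _).
by apply: eq_bigr => j _; rewrite ltn_ord.
Qed.

End FritzJohn.

Local Open Scope complex_scope.
Local Open Scope sesquilinear_scope.

(** * Positive semidefinite complex matrices *)

Lemma sesquilinear_formB (K : comNzRingType) n (A : 'M[K]_n) (x' z' : 'rV[K]_n)
    (x z : 'cV[K]_n) (e : K) :
  (x' - e *: z') *m A *m (x - e *: z) =
  x' *m A *m x - e *: (z' *m A *m x) - (e *: (x' *m A *m z) -
  e *: (e *: (z' *m A *m z))).
Proof.
by rewrite mulmxBl mulmxBr !mulmxBl -!scalemxAr -!scalemxAl.
Qed.

Section PositiveSemidefinite.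
Context {R : realType}.
Local Notation C := R[i].

Lemma complex_ReD (x y : C) : complex.Re (x + y) = complex.Re x + complex.Re y.
Proof. by case: x; case: y. Qed.

Lemma conj_real (a : R) : Num.conj (a%:C : C) = a%:C.
Proof. exact: conjc_real. Qed.

Lemma adjmxM m n p (A : 'M[C]_(m, n)) (B : 'M[C]_(n, p)) :
  (A *m B)^t* = B^t* *m A^t*.
Proof. by rewrite trmx_mul map_mxM. Qed.

Lemma sqnormE M (x : 'cV[C]_M) : sqnorm x = (x^t* *m x) 0 0.
Proof.
by rewrite mxE; apply: eq_bigr => i _; rewrite !mxE normCK mulrC.
Qed.

Lemma sqnorm_ge0 M (x : 'cV[C]_M) : 0 <= sqnorm x.
Proof. by apply: sumr_ge0 => i _; rewrite exprn_ge0. Qed.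

Lemma sqnorm_eq0 M (x : 'cV[C]_M) : sqnorm x = 0 -> x = 0.
Proof.
move=> /eqP; rewrite psumr_eq0 => [/allP x0|i _]; last by rewrite exprn_ge0.
apply/matrixP => i j; rewrite ord1 mxE.
by have := x0 i (mem_index_enum _); rewrite expf_eq0 normr_eq0 => /eqP.
Qed.

Lemma hermsymmxP n (A : 'M[C]_n) : reflect (A^t* = A) (A \is hermsymmx).
Proof.
apply: (iffP (is_hermitianmxP _ _ _)); rewrite expr0 scale1r //.
Qed.

Lemma form_row_gram M (h : 'rV[C]_M) (x : 'cV[C]_M) :
  (x^t* *m (h^t* *m h) *m x) 0 0 = `|(h *m x) 0 0| ^+ 2.
Proof.
rewrite mulmxA -adjmxM -mulmxA mxE big_ord1 !mxE normCK mulrC.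
by congr (_ * _); rewrite !mxE.
Qed.

Lemma psdmx_gram d M (F : 'M[C]_(d, M)) : psdmx (F^t* *m F).
Proof.
split; first by apply/hermsymmxP; rewrite adjmxM trmxCK.
by move=> x; rewrite mulmxA -adjmxM -mulmxA -sqnormE sqnorm_ge0.
Qed.

Lemma psdmx0 M : psdmx (0 : 'M[C]_M).
Proof.
split; first by apply/hermsymmxP; rewrite trmx0 map_mx0.
by move=> x; rewrite mulmx0 mul0mx mxE.
Qed.

Lemma psdmxD M (A B : 'M[C]_M) : psdmx A -> psdmx B -> psdmx (A + B).
Proof.
move=> [/hermsymmxP hA pA] [/hermsymmxP hB pB]; split.
  by apply/hermsymmxP; rewrite linearD map_mxD hA hB.
by move=> x; rewrite mulmxDr mulmxDl mxE addr_ge0.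
Qed.

Lemma psdmxZ M (a : R) (A : 'M[C]_M) : 0 <= a -> psdmx A -> psdmx (a%:C *: A).
Proof.
move=> a0 [/hermsymmxP hA pA]; split.
  apply/hermsymmxP; rewrite linearZ map_mxZ hA; congr (_ *: _).
  exact: conj_real.
by move=> x; rewrite -scalemxAr -scalemxAl mxE mulr_ge0 // ler0c.
Qed.

Lemma psdmx_sum M (I : finType) (A : I -> 'M[C]_M) :
  (forall i, psdmx (A i)) -> psdmx (\sum_i A i).
Proof.
move=> pA.
exact: (@big_ind _ (@psdmx R M) _ _ (@psdmx0 M) (@psdmxD M) _ _ _ _ (fun i _ => pA i)).
Qed.

(** If [z = A x] were nonzero, the form would be negative at [x - e z] for small [e > 0]: the term
    linear in [e] is [- 2 e |z|^2], and there is no constant term. *)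
Lemma psdmx_kernel M (A : 'M[C]_M) (x : 'cV[C]_M) :
  psdmx A -> (x^t* *m A *m x) 0 0 = 0 -> A *m x = 0.
Proof.
move=> [/hermsymmxP hA pA] xAx0; set z := A *m x.
apply: sqnorm_eq0; have n0 := sqnorm_ge0 z; set n := sqnorm z in n0 *.
set c := (z^t* *m A *m z) 0 0; have c0 : 0 <= c := pA z.
have c1 : 0 < c + 1 by rewrite ltr_wpDl.
(* Adding 1 keeps the denominator positive when [c = 0]. Since [e * c = n - e], the form at
   [x - e z] equals [- (e * n + e * e)]. *)
pose e := n / (c + 1); have e0 : 0 <= e by rewrite divr_ge0 // ltW.
have eJ : Num.conj e = e by apply/CrealP; exact: ger0_real.
have zz : z^t* *m z = n%:M by rewrite [LHS]mx11_scalar -sqnormE.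
have xAz : x^t* *m A *m z = n%:M by rewrite -zz adjmxM hA.
have zAx : z^t* *m A *m x = n%:M by rewrite -zz mulmxA.
have := pA (x - e *: z).
have -> : (x - e *: z)^t* = x^t* - e *: z^t*.
  by rewrite linearB linearZ /= map_mxB map_mxZ /= eJ.
rewrite sesquilinear_formB xAz zAx.
have xAx : x^t* *m A *m x = 0%:M by rewrite [LHS]mx11_scalar xAx0.
have zAz : z^t* *m A *m z = c%:M by rewrite [LHS]mx11_scalar.
rewrite xAx zAz !mxE !mulr1n.
have -> : e * c = n - e by rewrite -(divfK (lt0r_neq0 c1) n) -/e; ring.
have [n_eq0 //|nn0] := eqVneq n 0.
have nP : 0 < n by rewrite lt_def nn0.
have eP : 0 < e by rewrite divr_gt0.
have -> : 0 - e * n - (e * n - e * (n - e)) = - (e * n + e * e) by ring.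
by rewrite oppr_ge0 lt_geF // addr_gt0 // mulr_gt0.
Qed.

(** Spectral theorem, with the square roots of the eigenvalues absorbed into the eigenvectors. *)
Lemma psdmx_rank1_sum M (B : 'M[C]_M) :
  psdmx B -> exists u : 'I_M -> 'cV[C]_M, B = \sum_k u k *m (u k)^t*.
Proof.
move=> [hB pB]; have /orthomx_spectralP := hermitian_normalmx hB.
set U := spectralmx B; set D := spectral_diag B.
have Uu : U \is unitarymx := spectral_unitarymx B.
rewrite invmx_unitary // => EB.
have D0 k : 0 <= D 0 k.
  have := pB ((row k U)^t*); rewrite trmxCK.
  suff -> : row k U *m B *m (row k U)^t* = (D 0 k)%:M by rewrite mxE mulr1n.
  rewrite EB !mulmxA -[row k U *m _]row_mul (unitarymxP Uu) -row_mul mul1mx -row_mul.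
  apply/matrixP => a b; rewrite !ord1 [RHS]mxE mulr1n.
  have -> : (row k U)^t* = col k (U^t*) by apply/matrixP => i j; rewrite !mxE.
  transitivity ((diag_mx D *m U *m U^t*) k k).
    by rewrite [LHS]mxE [RHS]mxE; apply: eq_bigr => j _; congr (_ * _); rewrite [LHS]mxE.
  by rewrite -mulmxA (unitarymxP Uu) mulmx1 mxE eqxx mulr1n.
exists (fun k => sqrtC (D 0 k) *: (row k U)^t*).
rewrite EB; apply/matrixP => i j; rewrite summxE mxE.
apply: eq_bigr => k _; rewrite mul_mx_diag !mxE big_ord1 !mxE.
set s := sqrtC (D 0 k); have -> : Num.conj (s * Num.conj (U k j)) = s * U k j.
  rewrite rmorphM; congr (_ * _); last exact: conjCK.
  by apply/CrealP/ger0_real; rewrite sqrtC_ge0.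
by rewrite mulrACA -expr2 sqrtCK mulrA [D 0 k * _]mulrC.
Qed.

Lemma trace_mul_rank1 M (A : 'M[C]_M) (u : 'cV[C]_M) :
  \tr (A *m (u *m u^t*)) = (u^t* *m A *m u) 0 0.
Proof. by rewrite mulmxA mxtrace_mulC mulmxA /mxtrace big_ord1. Qed.

Lemma psdmx_trace_mul_ge0 M (A B : 'M[C]_M) :
  psdmx A -> psdmx B -> 0 <= \tr (A *m B).
Proof.
move=> [_ pA] /psdmx_rank1_sum[u ->].
by rewrite mulmx_sumr linear_sum sumr_ge0 // => k _; rewrite /= trace_mul_rank1.
Qed.

(** Writing [B] as a sum of [u u^H] makes the trace a sum of nonnegative values of the form of [A].
    Each of them vanishes, so each [u] lies in the kernel of [A]. *)
Lemma psdmx_trace_mul_eq0 M (A B : 'M[C]_M) :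
  psdmx A -> psdmx B -> \tr (A *m B) = 0 -> A *m B = 0.
Proof.
move=> pA /psdmx_rank1_sum[u ->].
rewrite mulmx_sumr linear_sum => /eqP; rewrite psumr_eq0 => [/allP tr0|k _]; last first.
  by rewrite /= trace_mul_rank1; case: pA.
apply: big1 => k _; rewrite mulmxA (psdmx_kernel pA) ?mul0mx //.
by rewrite -trace_mul_rank1; apply/eqP/tr0; rewrite mem_index_enum.
Qed.

Lemma psdmx_trace_ge0 M (A : 'M[C]_M) : psdmx A -> 0 <= \tr A.
Proof.
move=> pA; have := @psdmx_gram M M 1%:M; rewrite trmx1 map_mx1 mul1mx => p1.
by have := psdmx_trace_mul_ge0 p1 pA; rewrite mul1mx.
Qed.

End PositiveSemidefinite.

(** * Passage between complex traces and real numbers *)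

Section RealMorphism.
Variables (F K : fieldType) (f : {rmorphism F -> K}).

Lemma rmorph_sumD (I : finType) (b : I -> F) c :
  f (\sum_i b i + c) = \sum_i f (b i) + f c.
Proof. by rewrite rmorphD rmorph_sum. Qed.

Lemma rmorph_slack (I : finType) (Q : pred I) (b : I -> F) a g c s :
  f (a / g - \sum_(i | Q i) b i - c - s) =
  f a / f g - \sum_(i | Q i) f (b i) - f c - f s.
Proof. by rewrite !rmorphB rmorphM fmorphV rmorph_sum. Qed.

End RealMorphism.

Section RealTrace.
Context {R : realType}.
Local Notation C := R[i].

(** Real-valued, so that the alternative over [R] applies. On products of two positive semidefinite
    matrices it loses nothing, by [psdmx_trE]. *)
Definition trRe M (A : 'M[C]_M) : R := complex.Re (\tr A).

Lemma complex_ReZ (a : R) (x : C) : complex.Re (a%:C * x) = a * complex.Re x.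
Proof. by case: x => b c /=; rewrite mul0r subr0. Qed.

Lemma trReD M (A B : 'M[C]_M) : trRe (A + B) = trRe A + trRe B.
Proof. by rewrite /trRe linearD complex_ReD. Qed.

Lemma trReZ M a (A : 'M[C]_M) : trRe (a%:C *: A) = a * trRe A.
Proof. by rewrite /trRe linearZ complex_ReZ. Qed.

Lemma trRe0 M : trRe (0 : 'M[C]_M) = 0.
Proof. by rewrite /trRe linear0. Qed.

Lemma trReN M (A : 'M[C]_M) : trRe (- A) = - trRe A.
Proof. by apply/eqP; rewrite -addr_eq0 -trReD addNr trRe0. Qed.

Lemma trRe_sum M (I : finType) (P : pred I) (A : I -> 'M[C]_M) :
  trRe (\sum_(i | P i) A i) = \sum_(i | P i) trRe (A i).
Proof. by apply: (big_morph _ (@trReD M) (@trRe0 M)). Qed.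

Lemma complex_geRe (x : C) : 0 <= x -> x = (complex.Re x)%:C.
Proof. by move=> /ger0_real/RRe_real. Qed.

Lemma Re_ge0 (x : C) : 0 <= x -> 0 <= complex.Re x.
Proof. by rewrite lecE => /andP[]. Qed.

Lemma psdmx_trE M (A B : 'M[C]_M) :
  psdmx A -> psdmx B -> \tr (A *m B) = (trRe (A *m B))%:C.
Proof. by move=> pA pB; rewrite -complex_geRe // psdmx_trace_mul_ge0. Qed.

Lemma psdmx_trRe_ge0 M (A B : 'M[C]_M) :
  psdmx A -> psdmx B -> 0 <= trRe (A *m B).
Proof. by move=> pA pB; rewrite Re_ge0 // psdmx_trace_mul_ge0. Qed.

(** The quadratic form of a Hermitian matrix equals its own conjugate, so its real part determines
    it. *)
Lemma psdmx_ReP M (A : 'M[C]_M) :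
  A \is hermsymmx -> (forall x : 'cV[C]_M, 0 <= trRe (A *m (x *m x^t*))) ->
  psdmx A.
Proof.
move=> hA pA; split=> // x; have := pA x; rewrite /trRe trace_mul_rank1.
set z := (_ *m x) 0 0 => z0; suff zR : z \is Num.real by rewrite -(RRe_real zR) ler0c.
apply/CrealP; rewrite {2}/z -(hermsymmxP _ hA) -{2}[x]trmxCK -!adjmxM mulmxA.
by rewrite [RHS]mxE [in RHS]mxE.
Qed.

End RealTrace.

(** * Lagrange multipliers of the semidefinite program *)

Section KuhnTucker.
Context {R : realType} {M KI : nat}.
Local Notation C := R[i].
Variables (h : 'I_KI -> 'rV[C]_M) (sigmasq gamma : 'I_KI -> R) (P : R).
Variable (G : 'M[C]_M).
Hypotheses (gamma_gt0 : forall i, 0 < gamma i) (psdG : psdmx G).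

Local Notation point := (('I_KI -> 'M[C]_M) * 'M[C]_M)%type.
Local Notation H i := ((h i)^t* *m h i).

Definition mix (s : R) (x y : point) : point :=
  (fun i => s%:C *: x.1 i + (1 - s)%:C *: y.1 i,
   s%:C *: x.2 + (1 - s)%:C *: y.2).

Definition sinr_slack i (x : point) : R :=
  trRe (H i *m x.1 i) / gamma i - \sum_(k | k != i) trRe (H i *m x.1 k)
  - trRe (H i *m x.2) - sigmasq i.

Definition power_slack (x : point) : R :=
  P - \sum_i trRe (x.1 i) - trRe x.2.

Definition energy (x : point) : R :=
  \sum_i trRe (G *m x.1 i) + trRe (G *m x.2).

(** Only the cone constraints restrict the domain; the SINR and power constraints receive
    multipliers. *)
Definition psd_point : set point :=
  [set x | (forall i, psdmx (x.1 i)) /\ psdmx x.2].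

Lemma convex_psd_point : convex_for mix psd_point.
Proof.
move=> s x y /andP[s0 s1] [px pxE] [py pyE]; have s1' : 0 <= 1 - s by rewrite subr_ge0.
by split=> [i|] /=; [exact: psdmxD (psdmxZ s0 (px i)) (psdmxZ s1' (py i))|
  exact: psdmxD (psdmxZ s0 pxE) (psdmxZ s1' pyE)].
Qed.

Lemma trRe_mix (A X Y : 'M[C]_M) s :
  trRe (A *m (s%:C *: X + (1 - s)%:C *: Y)) =
  s * trRe (A *m X) + (1 - s) * trRe (A *m Y).
Proof. by rewrite mulmxDr -!scalemxAr trReD !trReZ. Qed.

Lemma affine_energy : affine_for mix energy.
Proof.
move=> s x y _; rewrite /energy !mulrDr addrACA !mulr_sumr -big_split /= trRe_mix.
by congr (_ + _); apply: eq_bigr => i _; rewrite trRe_mix.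
Qed.

Lemma affine_power_slack : affine_for mix power_slack.
Proof.
move=> s x y _; rewrite /power_slack /= trReD !trReZ.
under eq_bigr do rewrite trReD !trReZ.
by rewrite big_split /= -!mulr_sumr; ring.
Qed.

Lemma affine_sinr_slack i : affine_for mix (sinr_slack i).
Proof.
move=> s x y _; rewrite /sinr_slack /=.
rewrite (trRe_mix (H i) (x.1 i) (y.1 i)) (trRe_mix (H i) x.2 y.2).
under eq_bigr => k _ do rewrite (trRe_mix (H i) (x.1 k) (y.1 k)).
by rewrite big_split /= -!mulr_sumr; field; rewrite gt_eqF.
Qed.

Lemma SDR1_feasibleE (x : point) : psd_point x ->
  SDR1_feasible h sigmasq gamma P x.1 x.2 <->
  (forall i, 0 <= sinr_slack i x) /\ 0 <= power_slack x.
Proof.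
move=> [px pxE]; rewrite /SDR1_feasible /sinr_slack /power_slack.
have trE (A : 'M[C]_M) : psdmx A -> \tr A = (trRe A)%:C.
  by move=> pA; rewrite -complex_geRe // psdmx_trace_ge0.
have trS : \sum_i \tr (x.1 i) + \tr x.2 = (\sum_i trRe (x.1 i) + trRe x.2)%:C.
  rewrite (rmorph_sumD (real_complex R)) (trE _ pxE).
  by under eq_bigr => i _ do rewrite (trE _ (px i)).
have sE i : \tr (H i *m x.1 i) / (gamma i)%:C -
    \sum_(k | k != i) \tr (H i *m x.1 k) - \tr (H i *m x.2) - (sigmasq i)%:C =
    (sinr_slack i x)%:C.
  have pH := psdmx_gram (h i).
  rewrite /sinr_slack (rmorph_slack (real_complex R)).
  rewrite (psdmx_trE pH (px i)) (psdmx_trE pH pxE).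
  by under eq_bigr => k _ do rewrite (psdmx_trE pH (px k)).
rewrite trS lecR; split=> [[f1 f2 _ _]|[f1 f2]].
  by split=> [i|]; [have := f1 i; rewrite sE ler0c|lra].
split=> // [i|]; first by rewrite sE ler0c; exact: f1.
lra.
Qed.

Lemma SDR1_objectiveE (x : point) : psd_point x ->
  SDR1_objective G x.1 x.2 = (energy x)%:C.
Proof.
move=> [px pxE]; rewrite /SDR1_objective /energy (rmorph_sumD (real_complex R)).
rewrite (psdmx_trE psdG pxE).
by under eq_bigr => i _ do rewrite (psdmx_trE psdG (px i)).
Qed.

(* [kkt_mx] and [kkt_energy_mx] are minus the coefficients of [W_i] and of [W_E] in the
   Lagrangian. *)
Definition kkt_energy_mx (b m : R) (l : 'I_KI -> R) : 'M[C]_M :=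
  b%:C%:M - m%:C *: G + \sum_i (l i)%:C *: H i.

Definition kkt_mx (b m : R) (l : 'I_KI -> R) i : 'M[C]_M :=
  kkt_energy_mx b m l - (l i * (1 + (gamma i)^-1))%:C *: H i.

(** Separates the constant of the Lagrangian from its linear part, so that the two can be compared
    by scaling the point. *)
Lemma lagrangianE b m l v (x : point) :
  b * power_slack x + m * (energy x - v) + \sum_i l i * sinr_slack i x =
  b * P - m * v - \sum_i l i * sigmasq i -
  (\sum_i trRe (kkt_mx b m l i *m x.1 i) + trRe (kkt_energy_mx b m l *m x.2)).
Proof.
have kE (Y : 'M[C]_M) : trRe (kkt_energy_mx b m l *m Y) =
    b * trRe Y - m * trRe (G *m Y) + \sum_i l i * trRe (H i *m Y).
  rewrite /kkt_energy_mx mulmxDl mulmxBl mul_scalar_mx -scalemxAl mulmx_suml.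
  rewrite !trReD trReN !trReZ trRe_sum; congr (_ + _).
  by apply: eq_bigr => i _; rewrite -scalemxAl trReZ.
have kiE i : trRe (kkt_mx b m l i *m x.1 i) =
    b * trRe (x.1 i) - m * trRe (G *m x.1 i) + \sum_k l k * trRe (H k *m x.1 i)
    - l i * (1 + (gamma i)^-1) * trRe (H i *m x.1 i).
  by rewrite mulmxBl trReD trReN kE -scalemxAl trReZ.
(* Completing the interference sum with the term [k = i] raises the coefficient of the useful signal
   from [1 / gamma i] to [1 + 1 / gamma i]. *)
have sE i : l i * sinr_slack i x = l i * (1 + (gamma i)^-1) * trRe (H i *m x.1 i)
    - \sum_k l i * trRe (H i *m x.1 k) - l i * trRe (H i *m x.2) - l i * sigmasq i.
  rewrite /sinr_slack -mulr_sumr [in RHS](bigD1 i) //=; ring.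
rewrite (eq_bigr _ (fun i _ => sE i)) (eq_bigr _ (fun i _ => kiE i)).
rewrite kE /energy /power_slack !sumrB !big_split /= !sumrN -!mulr_sumr.
rewrite [\sum_i \sum_k l i * _]exchange_big /=; ring.
Qed.

Lemma kkt_matrices_hermitian b m l : kkt_energy_mx b m l \is hermsymmx /\
  forall i, kkt_mx b m l i \is hermsymmx.
Proof.
have herm0 a (A : 'M[C]_M) : psdmx A -> (a%:C *: A)^t* = a%:C *: A.
  case=> /hermsymmxP hA _; rewrite linearZ map_mxZ hA; congr (_ *: _).
  exact: conj_real.
have hE : (kkt_energy_mx b m l)^t* = kkt_energy_mx b m l.
  rewrite /kkt_energy_mx -scalemx1 linearD linearB map_mxD map_mxB; congr (_ - _ + _).
  - apply: herm0; have := @psdmx_gram R M M 1%:M.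
    by rewrite trmx1 map_mx1 mul1mx.
  - exact: herm0.
  - rewrite linear_sum raddf_sum; apply: eq_bigr => i _; apply: herm0.
    exact: psdmx_gram.
split=> [|i]; apply/hermsymmxP => //.
rewrite linearB map_mxB hE; congr (_ - _); apply: herm0; exact: psdmx_gram.
Qed.

(** At an optimum no point of the cone makes the power slack, all SINR slacks and the energy gain
    positive together, so [affine_multipliers] applies. The multiplier [m] of the objective may
    vanish; the disjunction records that not all multipliers do. *)
Lemma KKT (x : point) :
  SDR1_optimal h sigmasq gamma P G x.1 x.2 ->
  exists b m : R, exists l : 'I_KI -> R,
    [/\ [/\ 0 <= b, 0 <= m & forall i, 0 <= l i],
        [\/ 0 < b, 0 < m | exists i, 0 < l i],
        b * P = m * energy x + \sum_i l i * sigmasq i,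
        psdmx (kkt_energy_mx b m l) /\ kkt_energy_mx b m l *m x.2 = 0 &
        forall i, psdmx (kkt_mx b m l i) /\ kkt_mx b m l i *m x.1 i = 0].
Proof.
move=> [fx xopt].
have psdx : psd_point x by case: fx.
have [sx px] := (SDR1_feasibleE psdx).1 fx.
(* Index 0 is the power, 1 the energy gain and [i.+2] the SINR of user [i]. The default 0 past the
   last user makes the family total and affine. *)
pose f k : point -> R := match k with
  | 0 => power_slack
  | 1 => fun y => energy y - energy x
  | k.+2 => fun y => if insub k is Some i then sinr_slack i y else 0 end.
have [| | |l [l0 lpos] lL] := @affine_multipliers R point mix KI.+2 f psd_point _
    convex_psd_point.
- by exists x.
- case=> [|[|k]]; first exact: affine_power_slack.
    move=> s y z s01; rewrite /= affine_energy //; ring.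
  rewrite /f; case: insub => [i|]; first exact: affine_sinr_slack.
  by move=> s y z _; rewrite !mulr0 addr0.
- move=> [y psdy fy].
  have yf : SDR1_feasible h sigmasq gamma P y.1 y.2.
    apply/SDR1_feasibleE => //; split; last exact: ltW (fy 0 isT).
    by move=> i; have := fy i.+2 (ltn_ord i); rewrite /= valK => /ltW.
  have := xopt _ _ yf; rewrite !SDR1_objectiveE // lecR leNgt.
  by have := fy 1 isT; rewrite /= subr_gt0 => ->.
pose lam (i : 'I_KI) := l i.+2.
exists (l 0%N), (l 1%N), lam.
have sumE y : \sum_(k < KI.+2) l k * f k y =
    l 0 * power_slack y + l 1 * (energy y - energy x) + \sum_i lam i * sinr_slack i y.
  rewrite !big_ord_recl /= addrA; congr (_ + _); apply: eq_bigr => i _.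
  by rewrite /= /bump /= !add1n valK.
pose cst := l 0 * P - l 1 * energy x - \sum_i lam i * sigmasq i.
pose Ae := kkt_energy_mx (l 0) (l 1) lam; pose Ai := kkt_mx (l 0) (l 1) lam.
pose lin (y : point) := \sum_i trRe (Ai i *m y.1 i) + trRe (Ae *m y.2).
have Lle y : psd_point y -> cst <= lin y.
  move=> /lL; rewrite sumE lagrangianE // subr_le0; exact.
have Lx : lin x <= cst.
  rewrite -subr_ge0 -lagrangianE // -/cst subrr mulr0 addr0.
  apply: addr_ge0; first exact: mulr_ge0 (l0 _) px.
  by apply: sumr_ge0 => i _; exact: mulr_ge0 (l0 _) (sx i).
(* The bound [cst <= lin y] at [y = 0] gives [cst <= 0]. At [y = 2 x], together with [lin x <= cst],
   it gives [cst <= 2 * cst]. Hence [cst = 0]. *)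
have lin0 : lin (fun=> 0, 0) = 0.
  by rewrite /lin /= mulmx0 trRe0 addr0 big1 // => i _; rewrite mulmx0 trRe0.
have psd00 : psd_point (fun=> 0, 0) by split=> [i|]; exact: psdmx0.
have lin2 : lin (fun i => 2%:R%:C *: x.1 i, 2%:R%:C *: x.2) = 2 * lin x.
  rewrite /lin /= -scalemxAr trReZ mulrDr mulr_sumr; congr (_ + _).
  by apply: eq_bigr => i _; rewrite -scalemxAr trReZ.
have psd2 : psd_point (fun i => 2%:R%:C *: x.1 i, 2%:R%:C *: x.2).
  case: psdx => a c.
  by split=> [i|]; [exact: (psdmxZ (ler0n R 2) (a i))|exact: (psdmxZ (ler0n R 2) c)].
have cst0 : cst = 0 by have := Lle _ psd00; have := Lle _ psd2; rewrite lin0 lin2; lra.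
have linx0 : lin x = 0.
  by have := Lle _ psdx; move: Lx; rewrite cst0; lra.
have [hAe hAi] := kkt_matrices_hermitian (l 0) (l 1) lam.
have gram (u : 'cV[C]_M) : psdmx (u *m u^t*).
  by have := psdmx_gram (u^t*); rewrite trmxCK.
(* Points with a single nonzero block [u u^H] isolate the quadratic form of one dual matrix. *)
have pAe : psdmx Ae.
  apply: psdmx_ReP => // u; rewrite -cst0.
  apply: le_trans (Lle (fun=> 0, u *m u^t*) _) _.
    by split=> [i|]; [exact: psdmx0|exact: gram].
  by rewrite /lin /= big1 ?add0r // => i _; rewrite mulmx0 trRe0.
have pAi i : psdmx (Ai i).
  apply: psdmx_ReP => // u; rewrite -cst0.
  apply: le_trans (Lle (fun k => if k == i then u *m u^t* else 0, 0) _) _.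
    by split=> [k|] /=; [case: ifP => _; [exact: gram|exact: psdmx0]|exact: psdmx0].
  rewrite /lin /= mulmx0 trRe0 addr0 (bigD1 i) //= eqxx big1 ?addr0 // => k /negbTE ->.
  by rewrite mulmx0 trRe0.
case: psdx => px1 px2.
have tr0 (A W : 'M[C]_M) : psdmx A -> psdmx W -> trRe (A *m W) = 0 -> A *m W = 0.
  by move=> pA pW t0; apply: psdmx_trace_mul_eq0 => //; rewrite psdmx_trE // t0.
(* Complementary slackness: [lin x = 0] is a sum of nonnegative traces, so each of them vanishes. *)
have s0 : 0 <= \sum_i trRe (Ai i *m x.1 i).
  by apply: sumr_ge0 => i _; exact: (psdmx_trRe_ge0 (pAi i) (px1 i)).
have e0 : 0 <= trRe (Ae *m x.2) by exact: (psdmx_trRe_ge0 pAe px2).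
have sum0 : \sum_i trRe (Ai i *m x.1 i) = 0 by move: linx0; rewrite /lin; lra.
split.
- by split=> [||i]; exact: l0.
- have [[|[|k]] kK lk] := lpos; first exact: Or31.
    exact: Or32.
  by apply: Or33; exists (Ordinal (kK : (k < KI)%N)).
- by move: cst0; rewrite /cst; lra.
- split; first exact: pAe.
  by apply: (tr0 _ _ pAe px2); move: linx0; rewrite /lin sum0 add0r.
- move=> i; split; first exact: pAi.
  apply: (tr0 _ _ (pAi i) (px1 i)); apply: (psumr_eq0P _ sum0) => // k _.
  exact: (psdmx_trRe_ge0 (pAi k) (px1 k)).
Qed.

(** * From the multipliers to the rank of the optimal solution *)

Lemma unitmx_col_kernel (A : 'M[C]_M) :
  (forall u : 'cV[C]_M, A *m u = 0 -> u = 0) -> A \in unitmx.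
Proof.
move=> inj; rewrite -unitmx_tr -row_free_unit -kermx_eq0.
apply/eqP/row_matrixP => j; rewrite row0; apply: trmx_inj; rewrite trmx0.
by apply: inj; apply: trmx_inj; rewrite trmx_mul trmxK -row_mul mulmx_ker row0 trmx0.
Qed.

(** Hermitian symmetry forces the row [t] to be a multiple of [v^H]; the factor is the value
    [v^H W v] of the form, hence nonnegative. *)
Lemma psdmx_colinear (W : 'M[C]_M) (v : 'cV[C]_M) (t : 'rV[C]_M) :
  psdmx W -> sqnorm v = 1 -> W = v *m t ->
  exists2 p : R, 0 <= p & W = p%:C *: (v *m v^t*).
Proof.
move=> [/hermsymmxP hW pW] v1 Wvt; pose s := (v^t* *m W *m v) 0 0.
have s0 : 0 <= s := pW v.
have vv : v^t* *m v = 1%:M by rewrite [LHS]mx11_scalar -sqnormE v1.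
have tE : v^t* *m W = t by rewrite Wvt mulmxA vv mul1mx.
have tJ : W *m v = t^t* by rewrite -tE adjmxM trmxCK hW.
have Wv : W *m v = s *: v.
  by rewrite {1}Wvt -mulmxA [t *m v]mx11_scalar mul_mx_scalar -tE.
exists (complex.Re s); first exact: Re_ge0.
by rewrite -complex_geRe // -{1}hW {1}Wvt adjmxM -tJ Wv -scalemxAl.
Qed.

(** The energy beam only consumes power and adds interference, so dropping it keeps the powers [p]
    feasible. *)
Lemma aligned_SDR1_point (v : 'cV[C]_M) (p : 'I_KI -> R) (pE : R) (x : point) :
  (forall i, 0 < sigmasq i) ->
  sqnorm v = 1 -> (forall i, 0 <= p i) -> 0 <= pE ->
  (forall i, x.1 i = (p i)%:C *: (v *m v^t*)) -> x.2 = pE%:C *: (v *m v^t*) ->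
  (forall i, 0 <= sinr_slack i x) -> 0 <= power_slack x ->
  aligned_feasible h sigmasq gamma P v.
Proof.
move=> sig0 v1 p0 pE0 x1 x2 sx px.
have trv : trRe (v *m v^t*) = 1.
  by rewrite /trRe mxtrace_mulC /mxtrace big_ord1 -sqnormE v1.
exists p; split=> //.
  move: px; rewrite /power_slack x2 trReZ trv.
  under eq_bigr do rewrite x1 trReZ trv mulr1.
  lra.
move=> i; pose a := complex.Re (`|(h i *m v) 0 0| ^+ 2).
have aE : `|(h i *m v) 0 0| ^+ 2 = a%:C by rewrite -complex_geRe // exprn_ge0.
have a0 : 0 <= a by rewrite Re_ge0 // exprn_ge0.
have tHa : trRe (H i *m (v *m v^t*)) = a.
  by rewrite /trRe trace_mul_rank1 form_row_gram.
have := sx i; rewrite /sinr_slack x1 x2 -!scalemxAr !trReZ tHa.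
under eq_bigr do rewrite x1 -scalemxAr trReZ tHa.
set D := \sum_(k | k != i) p k * a => slack.
have D0 : 0 <= D by apply: sumr_ge0 => k _; apply: mulr_ge0.
have Ds : 0 < D + sigmasq i by rewrite ltr_wpDl.
have -> : \sum_(k | k != i) (p k)%:C * `|(h i *m v) 0 0| ^+ 2 + (sigmasq i)%:C
    = (D + sigmasq i)%:C.
  rewrite rmorphD rmorph_sum /=; congr (_ + _).
  by apply: eq_bigr => k _; rewrite aE rmorphM.
rewrite aE -rmorphM -fmorphV -rmorphM lecR ler_pdivlMr // mulrC -ler_pdivlMr //.
have : 0 <= pE * a by apply: mulr_ge0.
lra.
Qed.

(** The genericity hypothesis serves twice: it excludes a singular [Ae] when some SINR multiplier is
    positive, and it makes the dominant eigenspace of [G] a line when all of them vanish. *)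
Lemma SDR1_optimal_rank1 (vE : 'cV[C]_M) (x : point) :
  (0 < KI)%N -> 0 < P -> (forall i, 0 < sigmasq i) -> G != 0 ->
  (forall i (b : R) (u : 'cV[C]_M),
     b != 0 -> G *m u = b%:C *: u -> h i *m u = 0 -> u = 0) ->
  unit_dominant_eigenvector G vE ->
  ~ aligned_feasible h sigmasq gamma P vE ->
  SDR1_optimal h sigmasq gamma P G x.1 x.2 ->
  (forall i, \rank (x.1 i) = 1%N) /\ x.2 = 0.
Proof.
move=> KI0 P0 sig0 Gn0 generic [xi [[_ xi_max] GvE vE1]] not_aligned xopt.
have fx : SDR1_feasible h sigmasq gamma P x.1 x.2 by case: xopt.
have psdx : psd_point x by case: fx.
have [sx px] := (SDR1_feasibleE psdx).1 fx.
have {psdx}[psdW psdWE] := psdx.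
have W_neq0 i : x.1 i != 0.
  apply/eqP => W0; have := sx i; rewrite /sinr_slack W0 mulmx0 trRe0 mul0r.
  have : 0 <= \sum_(k | k != i) trRe (H i *m x.1 k).
    by apply: sumr_ge0 => k _; exact: (psdmx_trRe_ge0 (psdmx_gram (h i)) (psdW k)).
  have : 0 <= trRe (H i *m x.2) by exact: (psdmx_trRe_ge0 (psdmx_gram (h i)) psdWE).
  have := sig0 i; lra.
have en0 : 0 <= energy x.
  apply: addr_ge0 (psdmx_trRe_ge0 psdG psdWE); apply: sumr_ge0 => i _.
  exact: (psdmx_trRe_ge0 psdG (psdW i)).
have [b [m [l [[b0 m0 l0] nz bP [pAe AeWE] pAi]]]] := KKT xopt.
set Ae := kkt_energy_mx b m l in pAe AeWE.
have [[u un0 Aeu]|Ae_inj] := pselect (exists2 u : 'cV[C]_M, u != 0 & Ae *m u = 0); last first.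
  have Ae_unit : Ae \in unitmx.
    apply: unitmx_col_kernel => u Aeu; apply/eqP/negP => /negP un0.
    by apply: Ae_inj; exists u.
  split=> [i|]; last by rewrite -[x.2](mulKmx Ae_unit) AeWE mulmx0.
  (* [A_i W_i = 0] reads [Ae W_i = c h_i^H h_i W_i], so [W_i] factors through the single column
     [Ae^-1 h_i^H]. *)
  apply/eqP; rewrite eqn_leq lt0n mxrank_eq0 W_neq0 andbT.
  have [_ /eqP] := pAi i; rewrite mulmxBl subr_eq0 -/Ae => /eqP AeW.
  rewrite -[x.1 i](mulKmx Ae_unit) AeW -scalemxAl -[H i *m _]mulmxA scalemxAr mulmxA.
  exact: leq_trans (mxrankM_maxr _ _) (rank_leq_row _).
exfalso.
(* On a kernel vector [u] of [Ae] the form of [A_i] is [- c |h_i u|^2], and it must be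
   nonnegative. *)
have lhu i : (l i)%:C *: (h i *m u) = 0.
  have [-> |ln0] := eqVneq (l i) 0; first by rewrite scale0r.
  have c0 : 0 < l i * (1 + (gamma i)^-1).
    by apply: mulr_gt0; [rewrite lt_def ln0 l0|rewrite addr_gt0 ?ltr01 ?invr_gt0].
  have := (pAi i).1.2 u; rewrite /kkt_mx -/Ae mulmxBr mulmxBl -mulmxA Aeu mulmx0 sub0r.
  rewrite mxE oppr_ge0 -scalemxAr -scalemxAl mxE form_row_gram.
  rewrite pmulr_rle0 ?ltcR // => hu.
  have : `|(h i *m u) 0 0| ^+ 2 == 0 by rewrite eq_le hu exprn_ge0.
  rewrite expf_eq0 normr_eq0 /= => /eqP hu0.
  by rewrite [h i *m u]mx11_scalar hu0 -scalemx1 scale0r scaler0.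
have Gu : b%:C *: u = m%:C *: (G *m u).
  move: Aeu; rewrite /Ae /kkt_energy_mx mulmxDl mulmxBl mul_scalar_mx -scalemxAl.
  rewrite mulmx_suml big1 ?addr0 => [/eqP|i _]; first by rewrite subr_eq0 => /eqP.
  by rewrite -scalemxAl -mulmxA scalemxAr lhu mulmx0.
have [[i li]|no_l] := pselect (exists i, 0 < l i).
  (* The noise term makes [b * P] positive. Then [m] cannot vanish, and [u] is an eigenvector of [G]
     for [b / m]. *)
  have b_gt0 : 0 < b.
    rewrite -(pmulr_lgt0 _ P0) bP ltr_wpDl ?mulr_ge0 //.
    rewrite (bigD1 i) //= ltr_pwDl ?mulr_gt0 // sumr_ge0 // => k _.
    by rewrite mulr_ge0 // ltW.
  have mn0 : m != 0.
    apply: contraNneq un0 => m_eq0; move: Gu; rewrite m_eq0 scale0r => /eqP.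
    by rewrite scaler_eq0 fmorph_eq0 gt_eqF.
  move/eqP: un0; apply; apply: (generic i (b / m)).
  - by rewrite mulf_neq0 ?invr_eq0 // gt_eqF.
  - rewrite mulrC rmorphM -scalerA Gu scalerA -rmorphM mulVf //.
    by rewrite rmorph1 scale1r.
  - have := lhu i => /eqP; rewrite scaler_eq0 fmorph_eq0 gt_eqF //= => /eqP; exact.
(* In the remaining case all SINR multipliers vanish, every dual matrix equals [b I - m G], and all
   blocks of [x] lie in one eigenspace of [G]. *)
have l_eq0 i : l i = 0.
  by apply/eqP; rewrite eq_le l0 andbT leNgt; apply/negP => li; apply: no_l; exists i.
have bPm : b * P = m * energy x.
  by rewrite bP big1 ?addr0 // => i _; rewrite l_eq0 mul0r.
have m_gt0 : 0 < m.
  rewrite lt_def m0 andbT; apply/eqP => m_eq0.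
  have /eqP : b * P = 0 by rewrite bPm m_eq0 mul0r.
  rewrite mulf_eq0 (gt_eqF P0) orbF => /eqP b_eq0.
  by case: nz => [| |[k]]; rewrite ?m_eq0 ?b_eq0 ?l_eq0 ltxx.
have mC0 : m%:C != 0 :> C by rewrite fmorph_eq0 gt_eqF.
have AeE : Ae = b%:C%:M - m%:C *: G.
  by rewrite /Ae /kkt_energy_mx big1 ?addr0 // => i _; rewrite l_eq0 scale0r.
have AiE i : kkt_mx b m l i = Ae by rewrite /kkt_mx l_eq0 mul0r scale0r subr0.
pose r := b / m.
have GW (W : 'M[C]_M) : Ae *m W = 0 -> G *m W = r%:C *: W.
  rewrite AeE mulmxBl mul_scalar_mx -scalemxAl => /eqP; rewrite subr_eq0 => /eqP bW.
  by rewrite /r mulrC rmorphM -scalerA bW scalerA -rmorphM mulVf ?gt_eqF // rmorph1 scale1r.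
have GWi i : G *m x.1 i = r%:C *: x.1 i by apply: GW; rewrite -(AiE i); case: (pAi i).
have GWE : G *m x.2 = r%:C *: x.2 := GW _ AeWE.
(* If [b = 0], both [G] and [- m G] are positive semidefinite, which forces [G = 0]. *)
have r_neq0 : r != 0.
  rewrite mulf_neq0 ?invr_eq0 ?(gt_eqF m_gt0) //; apply: contraNneq Gn0 => b_eq0.
  apply/eqP/matrixP => i j; pose y : 'cV[C]_M := delta_mx j 0.
  have Gy : G *m y = 0.
    apply: psdmx_kernel => //; apply/eqP; rewrite eq_le psdG.2 andbT.
    have := pAe.2 y; rewrite AeE b_eq0 raddf0 sub0r mulmxN mulNmx mxE oppr_ge0.
    by rewrite -scalemxAr -scalemxAl mxE pmulr_rle0 // ltcR.
  by have /matrixP/(_ i 0) := Gy; rewrite -colE !mxE.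
have i0 : 'I_KI := Ordinal KI0.
have vE_neq0 : vE != 0.
  apply/eqP => vE_0; move: vE1; rewrite vE_0 sqnormE mulmx0 mxE => /esym/eqP.
  by rewrite oner_eq0.
(* The form of [Ae] at [vE] gives [xi <= r]. A nonzero row of [W_i0] is a left eigenvector of [G]
   for [r], which gives the converse. *)
have xi_r : xi = r.
  apply/eqP; rewrite eq_le; apply/andP; split.
    have := pAe.2 vE; rewrite AeE mulmxBr mulmxBl mul_mx_scalar -scalemxAr -!scalemxAl.
    rewrite -mulmxA GvE -scalemxAr scalerA -scalerBl mxE -sqnormE vE1 mulr1.
    rewrite -rmorphM -rmorphB ler0c subr_ge0 => bm.
    by rewrite ler_pdivlMr // mulrC.
  rewrite -lecR; apply: xi_max.
  have WG : x.1 i0 *m G = r%:C *: x.1 i0.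
    have := congr1 (fun A => A^t*) (GWi i0); rewrite adjmxM.
    rewrite (hermsymmxP _ psdG.1) (hermsymmxP _ (psdW i0).1) => ->.
    rewrite linearZ map_mxZ (hermsymmxP _ (psdW i0).1); congr (_ *: _).
    exact: conj_real.
  have [k Wk] : exists k, row k (x.1 i0) != 0.
    apply/existsP; apply: contra_neqT (W_neq0 i0); rewrite negb_exists => /forallP rk0.
    by apply/row_matrixP => k; rewrite row0; apply/eqP; have := rk0 k; rewrite negbK.
  by apply/eigenvalueP; exists (row k (x.1 i0)) => //; rewrite -row_mul WG linearZ.
rewrite xi_r in GvE.
have hc := mx11_scalar (h i0 *m vE).
have hv : (h i0 *m vE) 0 0 != 0.
  apply: contraNneq vE_neq0 => hv0; apply/eqP/(generic i0 r) => //.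
  by rewrite [LHS]mx11_scalar hv0 -scalemx1 scale0r.
(* Subtracting from each column the multiple of [vE] with the same product by [h i0] leaves an
   eigenvector orthogonal to [h i0], which is zero by genericity. *)
have colin (W : 'M[C]_M) : G *m W = r%:C *: W ->
    W = vE *m (((h i0 *m vE) 0 0)^-1 *: (h i0 *m W)).
  set c := (h i0 *m vE) 0 0 in hv hc *.
  move=> GWr; apply/eqP; rewrite -subr_eq0; apply/eqP/matrixP => k j.
  set Z := _ - _; have GZ : G *m Z = r%:C *: Z.
    by rewrite mulmxBr GWr mulmxA GvE -scalemxAl -scalerBr.
  have hZ : h i0 *m Z = 0.
    rewrite mulmxBr mulmxA hc mul_scalar_mx scalerA.
    by rewrite mulfV // scale1r subrr.
  have Zj : col j Z = 0.
    apply: (generic i0 r) => //; rewrite !colE mulmxA ?GZ ?hZ -?scalemxAl //.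
    by rewrite mul0mx.
  by have /matrixP/(_ k 0) := Zj; rewrite !mxE.
have cW W : psdmx W -> G *m W = r%:C *: W -> exists2 p : R, 0 <= p & W = p%:C *: (vE *m vE^t*).
  by move=> pW /colin; apply: psdmx_colinear.
have [pE pE0 x2] := cW _ psdWE GWE.
have /choice[p pP] i : exists p : R, 0 <= p /\ x.1 i = p%:C *: (vE *m vE^t*).
  by have [p p0 pW] := cW _ (psdW i) (GWi i); exists p.
apply: not_aligned; apply: (@aligned_SDR1_point vE p pE x) => // i; by case: (pP i).
Qed.

End KuhnTucker.

(** * Krylov matrices and eigenvectors *)

Section Krylov.
Variable F : fieldType.

(** The powers of [G] start at exponent 1, so that every row lies in the row space of [G]. *)
Definition krylov_mx r n (G : 'M[F]_n) (h : 'rV[F]_n) : 'M[F]_(r, n) :=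
  \matrix_(k < r) iter k.+1 (mulmxr G) h.

(** By the rank bound, [r] independent rows [h G^k] span the row space of [G]. Each of them sends
    [u] to [b^k h u = 0], so [G u = 0]. *)
Lemma krylov_kernel r n (G : 'M[F]_n) (h : 'rV[F]_n) (b : F) (u : 'cV[F]_n) :
  (\rank G <= r)%N -> row_free (krylov_mx r G h) ->
  b != 0 -> G *m u = b *: u -> h *m u = 0 -> u = 0.
Proof.
move=> rG /eqP rK b0 Gu hu; set K := krylov_mx r G h in rK.
have KG : (K <= G)%MS.
  by apply/row_subP => k; rewrite rowK /= submxMl.
have /submxP[D GD] : (G <= K)%MS by rewrite -(geq_leqif (mxrank_leqif_sup KG)) rK.
have iteru k : iter k (mulmxr G) h *m u = b ^+ k *: (h *m u).
  elim: k => [|k IHk]; first by rewrite scale1r.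
  by rewrite /= -mulmxA Gu -scalemxAr IHk scalerA exprS.
have Ku : K *m u = 0.
  by apply/row_matrixP => k; rewrite row_mul rowK iteru hu scaler0 row0.
by apply/eqP; move/eqP: Gu; rewrite GD -mulmxA Ku mulmx0 eq_sym scaler_eq0 (negbTE b0).
Qed.

Lemma row_free_colsub r n (f : 'I_r -> 'I_n) (K : 'M[F]_(r, n)) :
  \det (colsub f K) != 0 -> row_free K.
Proof.
move=> det0; rewrite /row_free eqn_leq rank_leq_row /=.
have rk : \rank (colsub f K) = r by apply: mxrank_unit; rewrite unitmxE unitfE.
rewrite -[X in (X <= _)%N]rk.
have -> : colsub f K = K *m colsub f 1%:M by rewrite mulmx_colsub mulmx1.
exact: mxrankM_maxl.
Qed.

Lemma mxrank_sum_le (I : finType) (Q : pred I) m n (A : I -> 'M[F]_(m, n)) :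
  (\rank (\sum_(i | Q i) A i)%R <= \sum_(i | Q i) \rank (A i))%N.
Proof.
apply: (big_ind2 (fun (B : 'M[F]_(m, n)) k => \rank B <= k)%N) => //.
  by rewrite mxrank0.
by move=> B1 k1 B2 k2 h1 h2; apply: leq_trans (mxrank_add _ _) (leq_add h1 h2).
Qed.

(** Taking one factor [a 0 l] out of each column leaves a Vandermonde matrix with distinct nodes. *)
Lemma det_power_mx_neq0 r (a : 'rV[F]_r) :
  (forall l, a 0 l != 0) -> injective (a 0) ->
  \det (\matrix_(k < r, l < r) a 0 l ^+ k.+1) != 0.
Proof.
move=> a0 a_inj.
have -> : \matrix_(k < r, l < r) a 0 l ^+ k.+1 = Vandermonde r a *m diag_mx a.
  by apply/matrixP => k l; rewrite mul_mx_diag !mxE exprSr.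
rewrite det_mulmx det_Vandermonde det_diag mulf_neq0 //.
  apply/prodf_neq0 => i _; apply/prodf_neq0 => j ij.
  by rewrite subr_eq0; apply: contraTneq ij => /a_inj ->; rewrite ltnn.
by apply/prodf_neq0 => i _.
Qed.

End Krylov.

(** * A polynomial certificate of genericity and a channel where it is nonzero *)

Section SpecialChannels.
Context {R : realType} {M KE : nat}.
Local Notation C := R[i].
Variables (zeta : R) (alpha : 'I_KE -> R).
Hypotheses (zeta_gt0 : 0 < zeta) (alpha_ge0 : forall j, 0 <= alpha j).

Local Notation active := [set j | 0 < alpha j]%SET.

(** The generic rank of [G]: only users with positive weight contribute. *)
Definition energy_rank := minn M #|active|.

Lemma psdmx_energy_mx (g : 'I_KE -> 'rV[C]_M) : psdmx (energy_mx zeta alpha g).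
Proof.
apply: (psdmxZ (ltW zeta_gt0)); apply: psdmx_sum => j.
exact: (psdmxZ (alpha_ge0 j) (psdmx_gram (g j))).
Qed.

Lemma energy_mx_rank (g : 'I_KE -> 'rV[C]_M) :
  (\rank (energy_mx zeta alpha g) <= energy_rank)%N.
Proof.
rewrite leq_min rank_leq_row /=; apply: leq_trans (mxrank_scale _ _) _.
rewrite (bigID (fun j => j \in active)) /= [X in _ + X]big1 ?addr0; last first.
  move=> j; rewrite inE => jn; have -> : alpha j = 0.
    by apply/eqP; rewrite eq_le alpha_ge0 andbT leNgt.
  by rewrite scale0r.
apply: leq_trans (mxrank_sum_le _ _) _.
rewrite -sum1_card; apply: leq_sum => j _.
apply: leq_trans (mxrank_scale _ _) _.
by apply: leq_trans (mxrankM_maxr _ _) (rank_leq_row _).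
Qed.

(** The trace of [G] is a nonnegative combination of the squared norms of the [g k], with positive
    weight at [j]. *)
Lemma energy_mx_neq0 (g : 'I_KE -> 'rV[C]_M) j :
  0 < alpha j -> g j != 0 -> energy_mx zeta alpha g != 0.
Proof.
move=> aj; apply: contraNneq => G0; apply/eqP.
have trE k : \tr ((g k)^t* *m g k) = sqnorm ((g k)^t*).
  by rewrite mxtrace_mulC /mxtrace big_ord1 sqnormE trmxCK.
have tr0 k : 0 <= (alpha k)%:C * sqnorm ((g k)^t*).
  by apply: mulr_ge0; [rewrite ler0c|exact: sqnorm_ge0].
have zC : zeta%:C != 0 :> C by rewrite fmorph_eq0 gt_eqF.
have : \sum_k (alpha k)%:C * sqnorm ((g k)^t*) = 0.
  transitivity (\tr (\sum_k (alpha k)%:C *: ((g k)^t* *m g k))).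
    rewrite linear_sum; apply: eq_bigr => k _.
    by rewrite -trE; symmetry; exact: linearZ.
  by apply: (mulfI zC); rewrite -mxtraceZ mulr0 -[_ *: _]/(energy_mx _ _ _) G0 mxtrace0.
move=> /(psumr_eq0P (fun k _ => tr0 k))/(_ j isT)/eqP.
rewrite mulf_eq0 fmorph_eq0 (gt_eqF aj) /= => /eqP/sqnorm_eq0 gj0.
by rewrite -[g j]trmxCK gj0 trmx0 map_mx0.
Qed.

(* A channel with [G] diagonal, carrying the eigenvalues [1, ..., energy_rank]. *)
Definition special_g (j : 'I_KE) : 'rV[C]_M :=
  \row_b if (b == index j (enum active) :> nat) && (b < energy_rank)%N
         then (Num.sqrt (b.+1%:R / (zeta * alpha j)))%:C else 0.

Lemma special_energy_mxE (a b : 'I_M) : (b < energy_rank)%N ->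
  energy_mx zeta alpha special_g a b = b.+1%:R *+ (a == b).
Proof.
move=> br; have bS : (b < size (enum active))%N.
  by rewrite -cardE; apply: leq_trans br (geq_minr _ _).
have [j0 j0E] : exists j0, index j0 (enum active) = b /\ j0 \in active.
  have [j0 _] : exists j0 : 'I_KE, true by case: (enum active) bS => // j l; exists j.
  exists (nth j0 (enum active) b); rewrite index_uniq ?enum_uniq //; split=> //.
  by rewrite -mem_enum mem_nth.
case: j0E => ij0 j0A; have aj0 : 0 < alpha j0 by move: j0A; rewrite inE.
rewrite mxE summxE (bigD1 j0) //= big1 ?addr0 => [|j jj0]; last first.
  rewrite mxE mxE big_ord1; have -> : special_g j 0 b = 0; last by rewrite !mulr0.
  rewrite mxE; case: ifP => // /andP[/eqP bj _].
  (* An inactive user has [index] equal to the length of the list, which exceeds [b]. *)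
  have jA : j \in enum active by rewrite -index_mem -bj.
  rewrite -mem_enum in j0A; case/eqP: jj0.
  by rewrite -(nth_index j0 jA) -bj -ij0 nth_index.
rewrite mxE mxE big_ord1; set s := Num.sqrt (b.+1%:R / (zeta * alpha j0)).
have gE c : special_g j0 0 c = s%:C *+ (c == b).
  rewrite mxE ij0 val_eqE; have [->|_] := eqVneq c b; last by rewrite mulr0n.
  by rewrite br.
have -> : (special_g j0)^t* a 0 = s%:C *+ (a == b).
  rewrite [LHS]mxE [X in Num.conj X]mxE gE.
  by case: (a == b); [exact: conj_real|exact: rmorph0].
rewrite gE eqxx; case: (a == b); last by rewrite !mulr0n mul0r !mulr0.
rewrite !mulr1n -!rmorphM -expr2 sqr_sqrtr; last first.
  by rewrite divr_ge0 ?ler0n // mulr_ge0 // ltW.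
by rewrite mulrA mulrC divfK ?rmorph_nat // mulf_neq0 // gt_eqF.
Qed.

(** One minor is fixed in place of the rank because it is polynomial in the real coordinates; when
    it is nonzero, the Krylov matrix has independent rows. *)
Definition leading_minor (h : 'rV[C]_M) (g : 'I_KE -> 'rV[C]_M) : C :=
  \det (colsub (widen_ord (geq_minl M #|active|))
    (krylov_mx energy_rank (energy_mx zeta alpha g) h)).

(** For the diagonal [G] and the all-ones [h], the entry at [(k, l)] is the power [k.+1] of the node
    [l.+1]. *)
Lemma special_leading_minor : leading_minor (const_mx 1) special_g != 0.
Proof.
rewrite /leading_minor; set w := widen_ord _; set G := energy_mx _ _ _.
pose a : 'rV[C]_energy_rank := \row_l l.+1%:R.
have it k (l : 'I_energy_rank) : iter k (mulmxr G) (const_mx 1) 0 (w l) = a 0 l ^+ k.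
  elim: k => [|k IHk]; first by rewrite mxE.
  rewrite /= mxE (bigD1 (w l)) //= big1 ?addr0 => [|i iwl].
    by rewrite IHk (@special_energy_mxE _ (w l) (ltn_ord l)) eqxx mulr1n exprSr !mxE.
  by rewrite (@special_energy_mxE _ (w l) (ltn_ord l)) (negbTE iwl) mulr0.
have -> : colsub w (krylov_mx energy_rank G (const_mx 1)) =
    \matrix_(k < energy_rank, l < energy_rank) a 0 l ^+ k.+1.
  by apply/matrixP => k l; rewrite [LHS]mxE [LHS]mxE [RHS]mxE it.
apply: det_power_mx_neq0 => [l|l l']; rewrite !mxE; first by rewrite pnatr_eq0.
by move/eqP; rewrite eqr_nat eqSS => /eqP/val_inj.
Qed.

Lemma leading_minor_generic (h : 'rV[C]_M) (g : 'I_KE -> 'rV[C]_M) b (u : 'cV[C]_M) :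
  leading_minor h g != 0 -> b != 0 ->
  energy_mx zeta alpha g *m u = b *: u -> h *m u = 0 -> u = 0.
Proof.
move=> /row_free_colsub rK; apply: krylov_kernel rK; exact: energy_mx_rank.
Qed.

End SpecialChannels.

(** * Polynomial functions of real variables and their zero sets *)

Section PolynomialFunctions.
Context {R : realType}.
Local Notation C := R[i].

(** The variables are real and the coefficients complex, so the class is stable under the
    conjugation that occurs in [G]. *)
Inductive polyfun (K : Type) : ((K -> R) -> C) -> Prop :=
| polyfun_const c : polyfun (fun=> c)
| polyfun_coord k : polyfun (fun x => (x k)%:C)
| polyfun_add f g : polyfun f -> polyfun g -> polyfun (fun x => f x + g x)
| polyfun_mul f g : polyfun f -> polyfun g -> polyfun (fun x => f x * g x).

Section Closure.
Variable K : Type.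
Implicit Types f g : (K -> R) -> C.

Lemma polyfun_sum (I : Type) (r : seq I) (Q : pred I) (f : I -> (K -> R) -> C) :
  (forall i, polyfun (f i)) -> polyfun (fun x => \sum_(i <- r | Q i) f i x).
Proof.
move=> pf; elim: r => [|i r IHr].
  by under eq_fun do rewrite big_nil; exact: polyfun_const.
under eq_fun do rewrite big_cons; case: (Q i) => //.
exact: polyfun_add (pf i) IHr.
Qed.

Lemma polyfun_prod (I : Type) (r : seq I) (Q : pred I) (f : I -> (K -> R) -> C) :
  (forall i, polyfun (f i)) -> polyfun (fun x => \prod_(i <- r | Q i) f i x).
Proof.
move=> pf; elim: r => [|i r IHr].
  by under eq_fun do rewrite big_nil; exact: polyfun_const.
under eq_fun do rewrite big_cons; case: (Q i) => //.
exact: polyfun_mul (pf i) IHr.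
Qed.

Lemma polyfun_conj f : polyfun f -> polyfun (fun x => Num.conj (f x)).
Proof.
elim=> {f} [c|k|f g _ pf _ pg|f g _ pf _ pg].
- exact: polyfun_const.
- by under eq_fun do rewrite conj_real; exact: polyfun_coord.
- by under eq_fun do rewrite rmorphD; exact: polyfun_add pf pg.
- by under eq_fun do rewrite rmorphM; exact: polyfun_mul pf pg.
Qed.

Lemma polyfun_comp (L : Type) f (u : (L -> R) -> K -> R) :
  polyfun f -> (forall k, polyfun (fun y => (u y k)%:C)) -> polyfun (fun y => f (u y)).
Proof.
move=> pf pu; elim: pf => {f} [c|k|f g _ pf _ pg|f g _ pf _ pg].
- exact: polyfun_const.
- exact: pu.
- exact: polyfun_add pf pg.
- exact: polyfun_mul pf pg.
Qed.

Lemma polyfun_poly f (u : R -> K -> R) : polyfun f ->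
  (forall k, exists p : {poly C}, forall s, (u s k)%:C = p.[s%:C]) ->
  exists p : {poly C}, forall s, f (u s) = p.[s%:C].
Proof.
move=> pf pu; elim: pf => {f} [c|k|f g _ [p pE] _ [q qE]|f g _ [p pE] _ [q qE]].
- by exists c%:P => s; rewrite hornerC.
- exact: pu.
- by exists (p + q) => s; rewrite hornerD pE qE.
- by exists (p * q) => s; rewrite hornerM pE qE.
Qed.

Definition polyfun_mx m n (A : (K -> R) -> 'M[C]_(m, n)) :=
  forall i j, polyfun (fun x => A x i j).

Lemma polyfun_mulmx m n p (A : (K -> R) -> 'M[C]_(m, n)) (B : (K -> R) -> 'M[C]_(n, p)) :
  polyfun_mx A -> polyfun_mx B -> polyfun_mx (fun x => A x *m B x).
Proof.
move=> pA pB i j; under eq_fun do rewrite mxE.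
by apply: polyfun_sum => k; exact: polyfun_mul (pA i k) (pB k j).
Qed.

Lemma polyfun_det n (A : (K -> R) -> 'M[C]_n) :
  polyfun_mx A -> polyfun (fun x => \det (A x)).
Proof.
move=> pA; rewrite /determinant; apply: polyfun_sum => s.
apply: polyfun_mul; first exact: polyfun_const.
by apply: polyfun_prod => i; exact: pA.
Qed.

Lemma polyfun_energy_mx M KE zeta (alpha : 'I_KE -> R) (g : 'I_KE -> (K -> R) -> 'rV[C]_M) :
  (forall j, polyfun_mx (g j)) ->
  polyfun_mx (fun x => energy_mx zeta alpha (fun j => g j x)).
Proof.
move=> pg a b; under eq_fun do rewrite mxE summxE.
apply: polyfun_mul; first exact: polyfun_const.
apply: polyfun_sum => j; under eq_fun do rewrite mxE.
apply: polyfun_mul; first exact: polyfun_const.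
apply: (polyfun_mulmx _ (pg j)) => i k.
by under eq_fun do rewrite mxE mxE; exact: polyfun_conj (pg j k i).
Qed.

Lemma polyfun_leading_minor M KE zeta (alpha : 'I_KE -> R)
    (h : (K -> R) -> 'rV[C]_M) (g : 'I_KE -> (K -> R) -> 'rV[C]_M) :
  polyfun_mx h -> (forall j, polyfun_mx (g j)) ->
  polyfun (fun x => leading_minor zeta alpha (h x) (fun j => g j x)).
Proof.
move=> ph pg; apply: polyfun_det => k l.
under eq_fun do rewrite mxE mxE.
have pk n : polyfun_mx
    (fun x => iter n (mulmxr (energy_mx zeta alpha (fun j => g j x))) (h x)).
  elim: n => [|n IHn] //.
  exact: (polyfun_mulmx IHn (polyfun_energy_mx _ _ pg)).
exact: (pk k.+1).
Qed.

End Closure.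

Section Measurability.
Context {K : Type} {d : measure_display} {S : measurableType d}.

Lemma measurable_polyfun (f : (K -> R) -> C) (u : S -> K -> R) :
  polyfun f -> (forall k, measurable_fun setT (fun s => u s k)) ->
  measurable_fun setT (fun s => complex.Re (f (u s))) /\
  measurable_fun setT (fun s => complex.Im (f (u s))).
Proof.
move=> pf mu; elim: pf => {f} [c|k|f g _ [fr fi] _ [gr gi]|f g _ [fr fi] _ [gr gi]].
- by split; exact: measurable_cst.
- by split; [exact: mu|exact: measurable_cst].
- split.
    by under eq_fun do rewrite complex_ReD; exact: measurable_funD.
  rewrite (_ : (fun s => _) = (fun s => complex.Im (f (u s)) + complex.Im (g (u s)))).
    exact: measurable_funD.
  by apply/funext => s; case: (f _) => ? ?; case: (g _).
- split.
    rewrite (_ : (fun s => _) = (fun s => complex.Re (f (u s)) * complex.Re (g (u s)) -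
      complex.Im (f (u s)) * complex.Im (g (u s)))).
      by apply: measurable_funB; exact: measurable_funM.
    by apply/funext => s; case: (f _) => ? ?; case: (g _).
  rewrite (_ : (fun s => _) = (fun s => complex.Re (f (u s)) * complex.Im (g (u s)) +
    complex.Im (f (u s)) * complex.Re (g (u s)))).
    by apply: measurable_funD; exact: measurable_funM.
  by apply/funext => s; case: (f _) => ? ?; case: (g _).
Qed.

Lemma measurable_polyfun_zeros (f : (K -> R) -> C) (u : S -> K -> R) :
  polyfun f -> (forall k, measurable_fun setT (fun s => u s k)) ->
  measurable [set s | f (u s) = 0].
Proof.
move=> pf mu; have [mr mi] := measurable_polyfun pf mu.
rewrite (_ : [set s | _] = (fun s => complex.Re (f (u s))) @^-1` [set 0] `&`
  (fun s => complex.Im (f (u s))) @^-1` [set 0]).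
  by apply: measurableI; rewrite -[X in measurable X]setTI;
    [exact: mr|exact: mi].
apply/seteqP; split=> s /= => [->//|[]].
by case: (f _) => a b /= -> ->.
Qed.

End Measurability.

Section NullSet.

(** Induction on the dimension. With the other coordinates frozen at [a], the first one ranges over
    a nonzero univariate polynomial with countable zero set [Z]. Off [Z] the section is a polynomial
    not vanishing at the tail of [a], so the inner integral is zero. *)
Lemma tuple_integral_polyfun_zeros n (f : ('I_n -> R) -> C) (a : 'I_n -> R)
    (F : n.-tuple R -> \bar R) :
  polyfun f -> f a != 0 ->
  (forall t, f (tnth t) != 0 -> F t = 0%E) -> tuple_integral F = 0%E.
Proof.
elim: n f a F => [|n IHn] f a F pf fa F0 /=.
  by apply: F0; rewrite (_ : tnth _ = a) //; apply/funext => -[].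
pose u (s : R) (y : 'I_n -> R) (k : 'I_n.+1) : R :=
  if unlift ord0 k is Some j then y j else s.
have [p pE] : exists p : {poly C}, forall s, f (u s (fun j => a (lift ord0 j))) = p.[s%:C].
  apply: polyfun_poly => // k; rewrite /u; case: unlift => [j|].
    by exists (a (lift ord0 j))%:C%:P => s; rewrite hornerC.
  by exists 'X => s; rewrite hornerX.
have p0 : p != 0.
  apply: contraNneq fa => p0; apply/eqP; have := pE (a ord0).
  rewrite p0 horner0 => <-; congr f; apply/funext => k; rewrite /u.
  by case: unliftP => [j|] ->.
pose Z : set R := [set s | p.[s%:C] = 0].
(* Over the complex numbers [p] splits, and the real parts of its finitely many roots cover [Z]. *)
have cZ : countable Z.
  have [r rE] := closed_field_poly_normal p.
  apply: (@sub_countable _ _ _ [set complex.Re z | z in [set` r]]); last first.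
    by apply: finite_set_countable; exact: finite_image.
  apply: subset_card_le => s /= ps0; exists s%:C => //=.
  move: (ps0 : p.[s%:C] = 0); rewrite rE hornerZ => /eqP.
  rewrite mulf_eq0 lead_coef_eq0 (negbTE p0) /=.
  by rewrite -[_ == 0]/(root _ _) root_prod_XsubC.
pose g x := tuple_integral (fun t => F (cons_tuple x t)).
have g0 x : ~ Z x -> g x = 0%E.
  move=> Zx; apply: (IHn (fun y => f (u x y)) (fun j => a (lift ord0 j))).
  - apply: polyfun_comp => // k; rewrite /u; case: unlift => [j|].
      exact: polyfun_coord.
    exact: polyfun_const.
  - by rewrite pE; apply/eqP.
  - move=> t ft; apply: F0; apply: contra_neq ft => <-; congr f; apply/funext => k.
    by rewrite /u; case: unliftP => [j|] ->; rewrite ?tnthS ?tnth0.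
have mset (B : set R) : B `<=` Z -> measurable B.
  move=> BZ; apply: countable_measurable; first exact: measurable_set1.
  by apply: sub_countable cZ; exact: subset_card_le.
(* [g] vanishes off [Z], so each preimage is a subset of the countable set [Z] or the complement of
   one. *)
have mg : measurable_fun setT g.
  move=> _ B mB; rewrite setTI; have [B0|nB0] := pselect (B 0%E).
    rewrite -[X in measurable X]setCK; apply: measurableC; apply: mset => x /= gBx.
    by apply: contrapT => /g0 gx; apply: gBx; rewrite /= gx.
  by apply: mset => x /= Bgx; apply: contrapT => /g0 gx; apply: nB0; rewrite -gx.
rewrite -[X in X = _]/(\int[lebesgue_measure]_x g x)%E.
rewrite (ae_eq_integral (cst 0%E)) ?integral0 //.
exists Z; split; [exact: mset|exact: countable_lebesgue_measure0|].
by move=> x /= ngx; apply: contrapT => /g0 gx; apply: ngx.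
Qed.

End NullSet.
End PolynomialFunctions.

(** * Null sets for pairs of independent variables *)

Section ProductNull.
Context {R : realType} {d d1 d2 : measure_display}.
Context {T : measurableType d} {T1 : measurableType d1} {T2 : measurableType d2}.
Variable Pr : probability T R.

(** Independence makes the joint law the product of the two laws, so the probability is the integral
    of the section probabilities, which vanish off [N]. *)
Lemma independent_null_sections (X : T -> T1) (Y : T -> T2) (N : set T1) (Z : set (T1 * T2)) :
  measurable_fun setT X -> measurable_fun setT Y ->
  (forall A B, measurable A -> measurable B ->
     Pr (X @^-1` A `&` Y @^-1` B) = (Pr (X @^-1` A) * Pr (Y @^-1` B))%E) ->
  measurable N -> measurable Z -> Pr (X @^-1` N) = 0%E ->
  (forall x, ~ N x -> Pr (Y @^-1` xsection Z x) = 0%E) ->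
  Pr [set t | Z (X t, Y t)] = 0%E.
Proof.
move=> mX mY indep mN mZ N0 Z0.
pose X' : {mfun T >-> T1} := HB.pack X (isMeasurableFun.Build _ _ _ _ X mX).
pose Y' : {mfun T >-> T2} := HB.pack Y (isMeasurableFun.Build _ _ _ _ Y mY).
have mXY : measurable_fun setT (fun t => (X t, Y t)) by exact: measurable_fun_pair.
pose XY' : {mfun T >-> (T1 * T2)%type} := HB.pack (fun t => (X t, Y t))
  (isMeasurableFun.Build _ _ _ _ _ mXY).
have XYE A B : measurable A -> measurable B -> distribution Pr XY' (A `*` B) =
    (distribution Pr X' A * distribution Pr Y' B)%E := indep A B.
have /esym := product_measure_unique XYE mZ.
rewrite -[X in X = _ -> _]/(Pr [set t | Z (X t, Y t)]) => ->.
rewrite /product_measure1 (ae_eq_integral (cst 0%E)) ?integral0 //.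
- exact: measurable_fun_xsection.
- by exists N; split=> // x /= nx; apply: contrapT => /Z0 Zx; apply: nx => _; exact: Zx.
Qed.

End ProductNull.

(** * Independent vectors with densities almost surely avoid polynomial zero sets *)

Section Hybrid.
Context {R : realType} {d : measure_display} {T : measurableType d}.
Variable Pr : probability T R.
Context {I : finType} {M : nat} (X : I -> T -> 'rV[R[i]]_M).
Local Notation V := ((M + M).-tuple R).
Local Notation Y := (fun i t => real_coords (X i t)).
Hypothesis mX : forall i, random_vector (X i).
Hypothesis indepX : mutually_independent Pr X.
Hypothesis densX : forall i, exists f, has_density Pr (X i) f.

Definition rectangles (J : {set I}) : set (set T) :=
  [set E | exists2 A : I -> set V, (forall i, measurable (A i)) &
    E = [set t | forall i, i \in J -> A i (Y i t)]].

(* The sample space itself, with the sigma-algebra generated by [X_i], [i \in J], is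
   used as the space of values of that subfamily. *)
Local Notation TJ J := (g_sigma_algebraType (rectangles J)).

Lemma rectangle_measurable J E : rectangles J E -> measurable E.
Proof.
move=> [A mA ->]; rewrite [X in measurable X](_ : _ = \bigcap_(i in [set` J]) (Y i @^-1` A i)).
  apply: fin_bigcap_measurable; first exact: finite_finset.
  by move=> i _; rewrite -[X in measurable X]setTI; exact: mX.
by [].
Qed.

Lemma measurable_id_rectangles J : measurable_fun setT (id : T -> TJ J).
Proof.
move=> _ E mE; rewrite setTI preimage_id.
have : <<s rectangles J >> E by [].
by apply: smallest_sub; [exact: sigma_algebra_measurable|exact: rectangle_measurable].
Qed.

Lemma measurable_coord_rectangles (J : {set I}) i : i \in J ->
  measurable_fun setT (Y i : TJ J -> V).
Proof.
move=> iJ _ B mB; rewrite setTI; apply: sub_sigma_algebra.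
exists (fun k => if k == i then B else setT) => [k|]; first by case: ifP.
apply/seteqP; split=> [t Bt k kJ /=|t /(_ i iJ) /=]; first by case: eqP => // ->.
by rewrite eqxx.
Qed.

(** With [D] the event on [X_i0], the finite measures [Pr (E & D)] and [Pr D * Pr E] of [E] agree on
    the rectangles, which are stable under intersection and generate the sigma-algebra. *)
Lemma independent_rectangles (J : {set I}) i0 (E : set (TJ J)) (B : set V) :
  i0 \notin J -> measurable E -> measurable B ->
  Pr (E `&` Y i0 @^-1` B) = (Pr E * Pr (Y i0 @^-1` B))%E.
Proof.
move=> i0J mE mB; set D := Y i0 @^-1` B.
have mD : measurable D by rewrite -[D]setTI; exact: mX.
have mid := @measurable_id_rectangles J.
pose id' : {mfun T >-> TJ J} := HB.pack (id : T -> TJ J) (isMeasurableFun.Build _ _ _ _ _ mid).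
have cE : (fine (Pr D))%:E = Pr D by rewrite fineK // fin_num_measure.
have c0 : (0 <= fine (Pr D))%R by rewrite fine_ge0.
pose m1' : {measure set (TJ J) -> \bar R} := pushforward (mrestr Pr mD) id'.
pose m1 := m1' mid.
pose m2 : {measure set (TJ J) -> \bar R} := mscale (NngNum c0) (distribution Pr id').
have -> : Pr (E `&` D) = m1 E by [].
rewrite muleC -cE -[RHS]/(m2 E).
apply: (@measure_unique _ _ (TJ J) (rectangles J) (fun=> setT) _ _ _ _ m1 m2 _ _ E mE) => //.
- move=> _ _ [A mA ->] [A' mA' ->]; exists (fun i => A i `&` A' i).
    by move=> i; exact: measurableI.
  apply/seteqP; split=> [t [At At'] i iJ|t AA]; first by split; [exact: At|exact: At'].
  by split=> i iJ; case: (AA i iJ).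
- by move=> n; exists (fun=> setT) => //; apply/seteqP; split.
- by rewrite bigcup_const //; exists 0%N.
- move=> _ [A mA ->]; rewrite -[LHS]/(Pr (_ `&` D)) -[RHS]/((fine (Pr D))%:E * Pr _)%E cE.
  (* Mutual independence is applied to [i0 |: J], with [B] placed at the new index. *)
  pose A' i := if i == i0 then B else A i.
  have mA' i : measurable (A' i) by rewrite /A'; case: ifP.
  have A'J i : i \in J -> A' i = A i.
    by move=> iJ; rewrite /A'; case: eqP => // ii0; rewrite -ii0 iJ in i0J.
  have := indepX (i0 |: J) mA'; rewrite big_setU1 //= {2}/A' eqxx.
  have -> : (\big[*%E/1%E]_(i in J) Pr [set t | A' i (Y i t)] =
      Pr [set t | forall i, i \in J -> A i (Y i t)])%E.
    rewrite (indepX J mA); apply: eq_bigr => i iJ; by rewrite A'J.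
  move=> <-; congr (Pr _); apply/seteqP; split=> t /=.
    move=> [At Dt] i; rewrite !inE => /predU1P[->|iJ]; first by rewrite /A' eqxx.
    by rewrite A'J //; exact: At.
  move=> A't; split=> [i iJ|]; first by rewrite -A'J //; apply: A't; rewrite !inE iJ orbT.
  by have := A't i0; rewrite !inE eqxx /= /A' eqxx; exact.
- by move=> _; rewrite -[X in (X < _)%E]/(Pr (setT `&` D)) setTI -cE ltry.
Qed.

Variables (f : ((I * 'I_(M + M)) -> R) -> R[i]) (a : I -> V).
Hypothesis pf : polyfun f.

(* Nonvanishing is passed from the point [a] to the random family [X] one index at a
   time, through the mixtures [hybrid J]. *)
Definition hybrid (J : {set I}) (t : T) (k : I * 'I_(M + M)) : R :=
  tnth (if k.1 \in J then Y k.1 t else a k.1) k.2.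

Lemma measurable_hybrid J k : measurable_fun setT (fun t : TJ J => hybrid J t k).
Proof.
rewrite /hybrid; case kJ: (k.1 \in J); last exact: measurable_cst.
apply: (measurableT_comp (measurable_tnth k.2)).
exact: measurable_coord_rectangles.
Qed.

(** Off the null set for [J], the polynomial in the coordinates of [X_i0] alone is nonzero at
    [a i0]. Its zero set therefore has probability zero, since [X_i0] has a density. *)
Lemma hybrid_step (J : {set I}) i0 : i0 \notin J ->
  Pr [set t | f (hybrid J t) = 0] = 0%E -> Pr [set t | f (hybrid (i0 |: J) t) = 0] = 0%E.
Proof.
move=> i0J null.
pose u (p : TJ J * V) k := if k.1 == i0 then tnth p.2 k.2 else hybrid J p.1 k.
have mu k : measurable_fun setT (fun p => u p k).
  rewrite /u; case: (k.1 == i0).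
    exact: (measurableT_comp (measurable_tnth k.2)).
  exact: (measurableT_comp (@measurable_hybrid J k)).
rewrite (_ : [set t | _] = [set t | [set p | f (u p) = 0] ((t : TJ J), Y i0 t)]); last first.
  apply/seteqP; split=> t /= <-; congr f; apply/funext => k; rewrite /u /hybrid !inE /=;
  by have [->|] := eqVneq k.1 i0.
apply: (@independent_null_sections _ _ _ _ _ (TJ J) _ Pr id (Y i0)
   [set t | f (hybrid J t) = 0]).
- exact: measurable_id_rectangles.
- exact: mX.
- by move=> A B mA mB; exact: (independent_rectangles i0J mA mB).
- exact: measurable_polyfun_zeros pf (@measurable_hybrid J).
- exact: measurable_polyfun_zeros pf mu.
- exact: null.
move=> t ft0; have [fd [_ _ dE]] := densX i0.
set Z := xsection _ t.
have mZ : measurable Z.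
  by apply: measurable_xsection; exact: measurable_polyfun_zeros pf mu.
rewrite -[LHS]/(Pr [set t | Z (real_coords (X i0 t))]) dE //.
pose w (y : 'I_(M + M) -> R) k := if k.1 == i0 then y k.2 else hybrid J t k.
apply: (@tuple_integral_polyfun_zeros _ _ (fun y => f (w y)) (tnth (a i0))).
- apply: polyfun_comp => // k; rewrite /w; case: (k.1 == i0).
    exact: polyfun_coord.
  exact: polyfun_const.
- apply/eqP; rewrite (_ : w _ = hybrid J t) //; apply/funext => k; rewrite /w /hybrid.
  by have [->|//] := eqVneq k.1 i0; rewrite (negbTE i0J).
- move=> v fv; rewrite indicE memNset ?mulr0 // => Zv; case/eqP: fv.
  by move: Zv; rewrite /Z /xsection /= inE.
Qed.

Lemma polyfun_ae_neq0 : f (fun k => tnth (a k.1) k.2) != 0 ->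
  {ae Pr, forall t, f (fun k => tnth (Y k.1 t) k.2) != 0}.
Proof.
move=> fa; have null n (J : {set I}) : #|J| = n -> Pr [set t | f (hybrid J t) = 0] = 0%E.
  elim: n J => [|n IHn] J cJ.
    rewrite (_ : [set t | _] = set0) ?measure0 //; apply/seteqP; split=> // t /= ft0.
    case/eqP: fa; rewrite -[RHS]ft0; congr f; apply/funext => k; rewrite /hybrid.
    by rewrite (cards0_eq cJ) inE.
  have [i0 i0J] : exists i0, i0 \in J by apply/set0Pn; rewrite -card_gt0 cJ.
  rewrite -(finset.setD1K i0J); apply: hybrid_step; first by rewrite !inE eqxx.
  by apply: IHn; move: cJ; rewrite (cardsD1 i0) i0J => -[].
have hT t : hybrid [set: I]%SET t = (fun k => tnth (Y k.1 t) k.2).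
  by apply/funext => k; rewrite /hybrid inE.
exists [set t | f (hybrid [set: I]%SET t) = 0]; split.
- apply: measurable_polyfun_zeros => // k; rewrite /hybrid.
  apply: (measurableT_comp (measurable_tnth k.2)).
  by rewrite inE; exact: mX.
- exact: (null _ _ erefl).
- by move=> t /= /negP; rewrite negbK hT => /eqP.
Qed.

End Hybrid.

(** * Complex rows as functions of real coordinates *)

Section ComplexCoordinates.
Context {R : realType} {M : nat}.
Local Notation C := R[i].

Definition complex_row (v : 'I_(M + M) -> R) : 'rV[C]_M :=
  \row_m ((v (lshift M m))%:C + 'i%C * (v (rshift M m))%:C).

Lemma real_coordsK (v : 'rV[C]_M) : complex_row (tnth (real_coords v)) = v.
Proof.
apply/rowP => m; rewrite mxE !tnth_mktuple.
rewrite -[lshift M m]/(unsplit (inl m)) -[rshift M m]/(unsplit (inr m)) !unsplitK.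
by rewrite -complexE.
Qed.

Lemma polyfun_complex_row (I : Type) (s : I) :
  polyfun_mx (fun x : I * 'I_(M + M) -> R => complex_row (fun k => x (s, k))).
Proof.
move=> i m; under eq_fun do rewrite mxE.
apply: polyfun_add; first exact: polyfun_coord.
apply: polyfun_mul; [exact: polyfun_const|exact: polyfun_coord].
Qed.

End ComplexCoordinates.

(** * Almost sure genericity of the channels *)

Section GenericChannels.
Context {R : realType} {M KI KE : nat} {d : measure_display} {T : measurableType d}.
Variables (Pr : probability T R) (zeta : R) (alpha : 'I_KE -> R).
Variables (h : 'I_KI -> T -> 'rV[R[i]]_M) (g : 'I_KE -> T -> 'rV[R[i]]_M).
Hypotheses (zeta_gt0 : 0 < zeta) (alpha_ge0 : forall j, 0 <= alpha j).
Hypothesis hchannel : channel_assumption Pr h g.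

Lemma ae_leading_minor_neq0 :
  {ae Pr, forall t, forall i, leading_minor zeta alpha (h i t) (fun j => g j t) != 0}.
Proof.
case: hchannel => mX indepX densX _.
suff ae_i i : {ae Pr, forall t, leading_minor zeta alpha (h i t) (fun j => g j t) != 0}.
  exact: filter_forall ae_i.
pose f (x : ('I_KI + 'I_KE) * 'I_(M + M) -> R) : R[i] :=
  leading_minor zeta alpha (complex_row (fun k => x (inl i, k)))
    (fun j => complex_row (fun k => x (inr j, k))).
have pf : polyfun f.
  by apply: polyfun_leading_minor => [|j]; exact: polyfun_complex_row.
(* The base point of the transfer, at which the minor is known to be nonzero. *)
pose b (s : 'I_KI + 'I_KE) : 'rV[R[i]]_M :=
  match s with inl _ => const_mx 1 | inr j => special_g zeta alpha j end.
have fE (v : 'I_KI + 'I_KE -> 'rV[R[i]]_M) :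
    f (fun k => tnth (real_coords (v k.1)) k.2) =
    leading_minor zeta alpha (v (inl i)) (fun j => v (inr j)).
  rewrite /f /= (real_coordsK (v (inl i))); congr (leading_minor _ _ _ _).
  by apply/funext => j; exact: real_coordsK.
have fb : f (fun k => tnth (real_coords (b k.1)) k.2) != 0.
  by rewrite [X in X != 0](fE b); exact: special_leading_minor.
apply: filterS (@polyfun_ae_neq0 _ _ _ _ _ _ _ mX indepX densX _
  (fun s => real_coords (b s)) pf fb) => t.
by rewrite [X in X != 0 -> _](fE (fun s => channels h g s t)).
Qed.

(** The rank condition of the channel assumption, applied to the one-row matrix formed by [g j]. *)
Lemma ae_energy_channel_neq0 j : (0 < M)%N -> {ae Pr, forall t, g j t != 0}.
Proof.
move=> M0; case: hchannel => _ _ _ /(_ 1%N (fun=> inr j)) [].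
- by rewrite M0.
- by move=> k l _; rewrite !ord1.
move=> N [mN N0 subN]; exists N; split=> // t /= gt; apply: subN => /= -[rk _].
apply: gt; apply/eqP => gt0; move: rk; rewrite (_ : channel_matrix _ _ _ _ = 0) ?mxrank0 //.
by apply/row_matrixP => k; rewrite rowK row0.
Qed.

End GenericChannels.

Theorem proposition3p1
  (R : realType) (M KI KE : nat)
  (hM : (1 < M)%N) (hKI : (0 < KI)%N) (hKE : (0 < KE)%N)
  (P : R) (hP : 0 < P)
  (sigmasq : 'I_KI -> R) (hsigmasq : forall i, 0 < sigmasq i)
  (gamma : 'I_KI -> R) (hgamma : forall i, 0 < gamma i)
  (alpha : 'I_KE -> R) (halpha : forall j, 0 <= alpha j)
  (* G <> 0, without which v_E is not determined and the claim is false *)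
  (halpha0 : exists j, 0 < alpha j)
  (zeta : R) (hzeta : 0 < zeta <= 1)
  (d : measure_display) (T : measurableType d) (Pr : probability T R)
  (h : 'I_KI -> T -> 'rV[R[i]]_M) (g : 'I_KE -> T -> 'rV[R[i]]_M)
  (hchannel : channel_assumption Pr h g) :
  {ae Pr, forall t : T,
    let ht := fun i => h i t in
    let G := energy_mx zeta alpha (fun j => g j t) in
    forall vE : 'cV[R[i]]_M,
      unit_dominant_eigenvector G vE ->
      nontrivial_case ht sigmasq gamma P vE ->
      forall (W : 'I_KI -> 'M[R[i]]_M) (WE : 'M[R[i]]_M),
        SDR1_optimal ht sigmasq gamma P G W WE ->
        (forall i, \rank (W i) = 1%N) /\ WE = 0}.
Proof.
have zeta0 : 0 < zeta by case/andP: hzeta.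
have M0 : (0 < M)%N := ltnW hM.
have [j0 aj0] := halpha0.
have minors := ae_leading_minor_neq0 zeta0 halpha hchannel.
(* On the intersection of these two almost sure events the claim is deterministic. *)
move: minors (ae_energy_channel_neq0 hchannel j0 M0); apply: filterS2.
move=> t minor gj0 vE vE_dom [_ not_al] W WE opt.
apply: (@SDR1_optimal_rank1 R M KI (fun i => h i t) sigmasq gamma P
  (energy_mx zeta alpha (fun j => g j t)) hgamma _ vE (W, WE)) => //.
- exact: psdmx_energy_mx.
- exact: energy_mx_neq0 aj0 gj0.
- move=> i b u b0 Gu; apply: (leading_minor_generic halpha (minor i) _ Gu).
  by rewrite fmorph_eq0.
Qed.
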